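(* Let $R$ be a Mori domain. The following conditions are equivalent: (i) $R$ is Clifford $w$-regular of $t$-dimension one (respectively, Clifford regular of dimension one); (ii) $R$ is Clifford $w$-regular and $R^{[w]}$ is a Krull domain (respectively, $R$ is Clifford regular and $R'$ is a Dedekind domain); (iii) $R$ is $w$-stable (respectively, stable). Under any one of these conditions, $R^{[w]}=\widetilde R$ (respectively, $R'=\widetilde R$) is the complete integral closure of $R$.
   Context: Let $R$ be an integral domain with field of fractions $K$. An ideal of $R$ means a nonzero fractional ideal; it is integral if it is contained in $R$. For $R$-submodules $I,J$ of $K$, $(J:I):=\{x\in K: xI\subseteq J\}$. For an ideal $I$: $I^d:=I$; $I^v:=(R:(R:I))$; $I^t:=\bigcup\{J^v : J\subseteq I \text{ a finitely generated ideal}\}$; $I^w:=\bigcap_{M\in t\text{-}\mathrm{Max}(R)}IR_M$, where $t\text{-}\mathrm{Max}(R)$ is the set of maximal elements among the proper integral ideals with $I=I^t$ (they are prime). $R$ is Mori if it satisfies the ascending chain condition on integral ideals with $I=I^v$. The $t$-dimension of $R$ is the supremum of the lengths $n$ of chains $(0)\subsetneq P_1\subsetneq\dots\subsetneq P_n$ with all $P_i$ nonzero prime ideals satisfying $P_i=P_i^t$; ''dimension'' is Krull dimension. For $\ast\in\{d,w\}$: $R$ is Clifford $\ast$-regular if for each ideal $I$ of $R$ there is an ideal $J$ of $R$ with $I^\ast=(I^2J)^\ast$; $R$ is $\ast$-stable if for each ideal $I$, with $E:=(I^\ast:I^\ast)$, $(I^\ast(E:I^\ast))^\ast=E$ ($\ast$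 being the operation of $R$; fractional ideals of $E$ are fractional ideals of $R$). ''Clifford regular'' and ''stable'' mean Clifford $d$-regular and $d$-stable. $R'$ is the integral closure of $R$ in $K$; $R^{[w]}:=\bigcup\{(J^w:J^w): J\text{ a finitely generated ideal of }R\}$ is the $w$-integral closure; $\widetilde R:=\bigcup\{(I^v:I^v): I\text{ an ideal of }R\}$ is the complete integral closure.
   Formalization: R is assumed not to be a field: a field is Mori and stable (its only ideal is K) but has dimension 0, so (iii) would hold while (i) fails. *)

(* Defs.v *)
(* A domain with field of fractions K is represented by its underlying subset
   A : set K.  This lets a domain R, embedded in {fraction R}, and its
   overrings in {fraction R} be handled uniformly. *)
From HB Require Import structures.
From mathcomp Require Import all_boot all_order all_algebra.
From mathcomp Require Import fraction.
From mathcomp Require Import boolp classical_sets functions cardinality.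

Set Implicit Arguments.
Unset Strict Implicit.
Unset Printing Implicit Defensive.

Import Order.TTheory GRing.Theory Num.Theory.
Local Open Scope classical_set_scope.
Local Open Scope ring_scope.

Definition base (R : idomainType) : set {fraction R} :=
  range (@FracField.tofrac R).
Arguments base R : clear implicits.

Section Ideals.
Variable K : fieldType.
Implicit Types (A I J M P V : set K) (star : set K -> set K).

Definition submodule A I : Prop :=
  [/\ I 0, (forall x y, I x -> I y -> I (x + y)) &
      (forall a x, A a -> I x -> I (a * x))].

(* Nonzero fractional ideals. *)
Definition ideal A I : Prop :=
  [/\ submodule A I, (exists2 x, I x & x != 0) &
      exists d, [/\ A d, d != 0 & forall x, I x -> A (d * x)]].

Definition integral_ideal A I : Prop := ideal A I /\ I `<=` A.

Definition colon J I : set K := [set x | forall y, I y -> J (x * y)].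

Definition mul I J : set K :=
  [set x | exists s : seq (K * K),
     (forall p, p \in s -> I p.1 /\ J p.2) /\ x = \sum_(p <- s) p.1 * p.2].

Definition span A (s : seq K) : set K :=
  [set x | exists c : nat -> K,
     (forall i, A (c i)) /\ x = \sum_(i < size s) c i * s`_i].

Definition fg_ideal A J : Prop := ideal A J /\ exists s, J = span A s.

Definition d_op I : set K := I.

Definition v_op A I : set K := colon A (colon A I).

Definition t_op A I : set K :=
  \bigcup_(J in [set J | fg_ideal A J /\ J `<=` I]) v_op A J.

Definition proper_t_ideal A I : Prop :=
  [/\ integral_ideal A I, I <> A & t_op A I = I].

Definition t_max A M : Prop :=
  proper_t_ideal A M /\ forall I, proper_t_ideal A I -> M `<=` I -> I = M.

(* I A_M, the set of fractions x / s with x in I and s in A \ M. *)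
Definition localize A I M : set K :=
  [set z | exists x s, [/\ I x, A s, ~ M s & z = x / s]].

Definition w_op A I : set K := \bigcap_(M in t_max A) localize A I M.

Definition acc (C : set K -> Prop) : Prop :=
  forall I : nat -> set K,
    (forall n, C (I n)) -> (forall n, I n `<=` I n.+1) ->
    exists N, forall n, (N <= n)%N -> I n = I N.

Definition mori A : Prop := acc (fun I => integral_ideal A I /\ v_op A I = I).

Definition noetherian A : Prop := acc (integral_ideal A).

Definition nonzero_prime A P : Prop :=
  [/\ integral_ideal A P, P <> A &
      forall x y, A x -> A y -> P (x * y) -> P x \/ P y].

(* A chain (0) < P_1 < ... < P_n, with P_(i+1) stored as P i; the first
   inclusion is strict because all members of C are nonzero below. *)
Definition has_chain (C : set K -> Prop) (n : nat) : Prop :=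
  exists P : nat -> set K,
    (forall i, (i < n)%N -> C (P i)) /\
    (forall i, (i.+1 < n)%N -> P i `<` P i.+1).

(* The supremum of the lengths of these chains is n. *)
Definition chain_dim (C : set K -> Prop) (n : nat) : Prop :=
  has_chain C n /\ forall m, has_chain C m -> (m <= n)%N.

Definition krull_dim A (n : nat) : Prop := chain_dim (nonzero_prime A) n.

Definition t_dim A (n : nat) : Prop :=
  chain_dim (fun P => nonzero_prime A P /\ t_op A P = P) n.

Definition clifford_regular A star : Prop :=
  forall I, ideal A I ->
    exists2 J, ideal A J & star I = star (mul (mul I I) J).

Definition stable A star : Prop :=
  forall I, ideal A I ->
    let E := colon (star I) (star I) in
    star (mul (star I) (colon E (star I))) = E.

Definition integral_closure A : set K :=
  [set x | exists p : {poly K},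
     [/\ p \is monic, (forall i, A p`_i) & root p x]].

Definition w_integral_closure A : set K :=
  \bigcup_(J in fg_ideal A) colon (w_op A J) (w_op A J).

Definition complete_integral_closure A : set K :=
  \bigcup_(I in ideal A) colon (v_op A I) (v_op A I).

Definition dedekind A : Prop :=
  [/\ noetherian A, integral_closure A = A & krull_dim A 1].

(* Normalized discrete valuations, v 0 being irrelevant. *)
Definition discrete_valuation (v : K -> int) : Prop :=
  [/\ (forall x y, x != 0 -> y != 0 -> v (x * y) = v x + v y),
      (forall x y, x != 0 -> y != 0 -> x + y != 0 ->
         Num.min (v x) (v y) <= v (x + y)) &
      forall n, exists2 x, x != 0 & v x = n].

Definition dvr V : Prop :=
  exists2 v, discrete_valuation v & V = [set x | x = 0 \/ 0 <= v x].

(* An intersection of DVRs of K, with finite character: every nonzero element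
   is a unit in all but finitely many of them. *)
Definition krull A : Prop :=
  exists F : set (set K),
    [/\ (forall V, F V -> dvr V), A = \bigcap_(V in F) V &
        forall x, x != 0 -> finite_set [set V | F V /\ ~ (V x /\ V x^-1)]].

End Ideals.

Arguments d_op {K} I _.

(* Main.v *)
(* All the conditions make R_M finitely stable (nonzero finitely generated
   ideals are invertible over their endomorphism rings) for every t-maximal M:
   if I = I (I J) locally with I finitely generated, the determinant trick
   gives 1 in I J (I : I).  The converse rests on the local case.  Let D be a
   finitely stable Mori local domain whose maximal ideal is divisorial.  Every
   module between D and its integral closure D' is a ring, so x^2 is in D + D x
   for x in D', and D' is a Pruefer domain with at most two maximal ideals.  The
   Mori property makes D' an intersection of two DVRs.  Hence D has dimension
   one and every fractional ideal of D contained in a multiple of D' is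
   principal over its endomorphism ring.  Finite character of the t-maximal
   ideals then globalizes this.
   For the operation d, each condition forces every maximal ideal to be a
   t-ideal, so that w is the identity on ideals. *)
From HB Require Import structures.
Require Import Defs.
From mathcomp Require Import all_boot all_order all_algebra.
From mathcomp Require Import fraction.
From mathcomp Require Import boolp classical_sets functions cardinality.
From mathcomp Require Import ring.
Import Defs.

Set Implicit Arguments.
Unset Strict Implicit.
Unset Printing Implicit Defensive.

Import Order.TTheory GRing.Theory Num.Theory.
Local Open Scope classical_set_scope.
Local Open Scope ring_scope.

(** * Modules over subrings of a field, the determinant trick, integral elements *)

Section Modules.
Variable K : fieldType.
Implicit Types (A B I J L : set K) (s : seq K).

(** The Mori condition speaks of divisorial ideals of D only, and D' need not be a finite D-module,
    so chains of ideals of D' give nothing directly. The bridge is the relation y^2 = r + t y with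
    r, t in D: for y = c/m^k in D' it shows that c^2/m^k = r m^k + t c is in D, so squaring brings
    divisibility in D' back to D. If D' has one maximal ideal, this makes its valuation ring
    archimedean. With two, divisibility at one of them says nothing about D' as a whole. The remedy
    is an element e that lies in one maximal ideal, is 1 modulo the other, and satisfies m^k e in D
    for some k: then D + De has a nonzero conductor, and its divisorial closure, scaled by powers of
    e, gives a chain of ideals of D. Here m is a nonzero element of the maximal ideal M of D that
    divides all of M in each localization of D' at a maximal ideal; it exists because M is the
    v-closure of a finitely generated ideal. The quadratic relation also gives n^2/m in V for every
    nonunit n of such a valuation ring V, which makes the maximal ideal of V principal. *)

Record rng L : Prop := Rng {
  rng0 : L 0;
  rngB : forall x y, L x -> L y -> L (x - y);
  rngM : forall x y, L x -> L y -> L (x * y) }.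

Definition subring A : Prop := rng A /\ A 1.

Lemma rngN L x : rng L -> L x -> L (- x).
Proof. by move=> rL Lx; rewrite -sub0r; apply: rngB => //; apply: rng0. Qed.

Lemma rngD L x y : rng L -> L x -> L y -> L (x + y).
Proof. by move=> rL Lx Ly; rewrite -[y]opprK; apply: rngB => //; apply: rngN. Qed.

Lemma subringX A x n : subring A -> A x -> A (x ^+ n).
Proof.
by move=> [rA A1] Ax; elim: n => [|n IH]; rewrite ?expr0 ?exprS //; apply: rngM.
Qed.

Lemma rng_sum L (T : Type) (r : seq T) (P : pred T) F :
  rng L -> (forall i, P i -> L (F i)) -> L (\sum_(i <- r | P i) F i).
Proof. by move=> rL LF; apply: big_ind => //; [exact: rng0|move=> *; exact: rngD]. Qed.

Lemma submodB A I x y : subring A -> submodule A I -> I x -> I y -> I (x - y).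
Proof.
move=> [rA A1] [I0 ID IZ] Ix Iy; apply: ID => //.
by rewrite -mulN1r; apply: IZ => //; apply: rngN.
Qed.

Lemma submod_sum A I (T : Type) (r : seq T) (P : pred T) F :
  submodule A I -> (forall i, P i -> I (F i)) -> I (\sum_(i <- r | P i) F i).
Proof. by case=> I0 ID IZ LF; apply: big_ind. Qed.

Lemma subring_submod A B :
  subring A -> subring B -> A `<=` B -> submodule A B.
Proof.
move=> sA [rB B1] AB; split; first exact: rng0.
  by move=> x y; apply: rngD.
by move=> a x /AB Ba Bx; apply: rngM.
Qed.

Lemma submod_self A : subring A -> submodule A A.
Proof. by move=> sA; apply: subring_submod. Qed.

Lemma span_submod A s : subring A -> submodule A (span A s).
Proof.
move=> [rA A1]; split.
- exists (fun=> 0); split=> [i|]; first exact: rng0.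
  by rewrite big1 // => i _; rewrite mul0r.
- move=> x y [c [Ac ->]] [d [Ad ->]]; exists (fun i => c i + d i).
  split=> [i|]; first exact: rngD.
  by rewrite -big_split; apply: eq_bigr => i _; rewrite mulrDl.
- move=> a x Aa [c [Ac ->]]; exists (fun i => a * c i); split=> [i|].
    exact: rngM.
  by rewrite mulr_sumr; apply: eq_bigr => i _; rewrite mulrA.
Qed.

Lemma mem_span A s x : subring A -> x \in s -> span A s x.
Proof.
move=> [rA A1] xs; exists (fun i => if i == index x s then 1 else 0).
split=> [i|]; first by case: ifP => // _; apply: rng0.
have lt : (index x s < size s)%N by rewrite index_mem.
rewrite (bigD1 (Ordinal lt)) //= eqxx mul1r nth_index // big1 ?addr0 // => i.
by rewrite -val_eqE /= => /negPf ->; rewrite mul0r.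
Qed.

Lemma span_min A I s :
  submodule A I -> (forall x, x \in s -> I x) -> span A s `<=` I.
Proof.
move=> mI Is x [c [Ac ->]]; apply: (submod_sum _ mI) => i _.
by case: mI => _ _ IZ; apply: IZ; [exact: Ac|apply/Is/mem_nth].
Qed.

Lemma span2P A x y z :
  span A [:: x; y] z <-> exists a b, [/\ A a, A b & z = a * x + b * y].
Proof.
split=> [[c [Ac ->]]|[a [b [Aa Ab ->]]]].
  by exists (c 0%N), (c 1%N); rewrite !big_ord_recl big_ord0 addr0.
exists (fun i => if i == 0%N then a else b); split; first by case.
by rewrite !big_ord_recl big_ord0 addr0.
Qed.

Lemma span_coefS A B s : A `<=` B -> span A s `<=` span B s.
Proof. by move=> AB x [c [Ac ->]]; exists c; split => // i; apply: AB. Qed.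

(* Gaussian elimination: the last equation either gives 1 = c n n or removes
   the last unknown. *)
Lemma nakayama_fun L n (f : nat -> K) (c : nat -> nat -> K) :
    rng L -> (forall i j, L (c i j)) ->
    (forall i, (i < n)%N -> f i = \sum_(j < n) c i j * f j) ->
  (exists2 i, (i < n)%N & f i != 0) -> L 1.
Proof.
move=> rL; elim: n f c => [|n IH] f c Lc E [i lt nz] //.
have [En|En] := eqVneq (c n n) 1; first by rewrite -En.
have Fn : f n * (1 - c n n) = \sum_(j < n) c n j * f j.
  rewrite mulrBr mulr1 {1}E // big_ord_recr /= mulrC; ring.
(* Substitute [Fn] into the i-th equation multiplied by 1 - c n n, then add c n n times f i to both
   sides: all coefficients stay in L, which need not contain 1. *)
pose d i j := (1 - c n n) * c i j + c i n * c n j +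
  (if i == j then c n n else 0).
apply: (IH f d).
- move=> k l; rewrite /d mulrBl mul1r; apply: rngD => //.
    by apply: rngD => //; [apply: rngB => //; apply: rngM|apply: rngM].
  by case: ifP => // _; apply: rng0.
- move=> k ltk; rewrite /d.
  rewrite (eq_bigr (fun j : 'I_n => (1 - c n n) * c k j * f j +
    c k n * c n j * f j + (if k == j then c n n else 0) * f j)); last first.
    by move=> j _; rewrite -!mulrDl.
  rewrite !big_split /=.
  have -> : \sum_(j < n) (if k == j then c n n else 0) * f j = c n n * f k.
    rewrite (bigD1 (Ordinal ltk)) //= eqxx big1 ?addr0 // => j.
    by rewrite -val_eqE /= eq_sym => /negPf ->; rewrite mul0r.
  have -> : \sum_(j < n) c k n * c n j * f j = c k n * (f n * (1 - c n n)).
    by rewrite Fn mulr_sumr; apply: eq_bigr => j _; rewrite mulrA.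
  have -> : \sum_(j < n) (1 - c n n) * c k j * f j =
            (1 - c n n) * (f k - c k n * f n).
    rewrite [f k]E; last exact: ltnW.
    rewrite big_ord_recr /= addrK mulr_sumr.
    by apply: eq_bigr => j _; rewrite mulrA.
  ring.
- move: lt; rewrite ltnS leq_eqVlt => /orP[/eqP Ei|lt]; last by exists i.
  apply: contrapT => H.
  have : f n * (1 - c n n) = 0.
    rewrite Fn big1 // => j _; have [->|fj] := eqVneq (f j) 0.
      by rewrite mulr0.
    by case: H; exists j.
  move/eqP; rewrite mulf_eq0 -Ei (negPf nz) /= subr_eq0 eq_sym.
  by rewrite Ei (negPf En).
Qed.

(** As [rng] asks for no unit, L may be an ideal; the conclusion then says that it is improper. *)
Lemma nakayama L s : rng L -> (exists2 x, x \in s & x != 0) ->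
  (forall x, x \in s -> span L s x) -> L 1.
Proof.
move=> rL [x xs nz] H.
have /choice[c Hc] (i : nat) : exists d : nat -> K, (forall j, L (d j)) /\
    ((i < size s)%N -> s`_i = \sum_(j < size s) d j * s`_j).
  have [lt|ge] := ltnP i (size s).
    by have [d [Ld E]] := H _ (mem_nth 0 lt); exists d.
  by exists (fun=> 0); split => // _; apply: rng0.
apply: (@nakayama_fun L (size s) (nth 0 s) c) => //.
- by move=> i; case: (Hc i).
- by move=> i lt; apply: (Hc i).2.
- by exists (index x s); rewrite ?index_mem ?nth_index.
Qed.

(* Elements multiplying some nonzero finitely generated D-module into itself;
   by the determinant trick these are the integral elements. *)
Definition integral_elt D : set K :=
  [set x | exists s, (exists2 y, y \in s & y != 0) /\
     forall y, y \in s -> span D s (x * y)].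

(** The products of the generators of two modules generate a module that is stable under the
    multipliers of both. *)
Lemma integral_common D (zs : seq K) : subring D ->
    (forall z, z \in zs -> integral_elt D z) ->
  exists s, (exists2 y, y \in s & y != 0) /\
    forall z y, z \in zs -> span D s y -> span D s (z * y).
Proof.
move=> sD; elim: zs => [|z zs IH] Hz.
  by exists [:: 1]; split => //; exists 1; rewrite ?inE ?oner_neq0.
have [|s [[y ys y0] Hs]] := IH.
  by move=> w wz; apply: Hz; rewrite inE wz orbT.
have [t [[w wt w0] Ht]] := Hz z (mem_head _ _).
pose r := [seq a * b | a <- s, b <- t].
have mr := span_submod r sD.
have prod a b : span D s a -> span D t b -> span D r (a * b).
  case: (mr) => r0 rD rZ Ha Hb.
  apply: (span_min (I := [set a | span D r (a * b)])) Ha => /=.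
    split=> /=; first by rewrite mul0r.
      by move=> *; rewrite mulrDl; apply: rD.
    by move=> *; rewrite -mulrA; apply: rZ.
  move=> {}a ias; apply: (span_min (I := [set b | span D r (a * b)])) Hb => /=.
    split=> /=; first by rewrite mulr0.
      by move=> *; rewrite mulrDr; apply: rD.
    by move=> *; rewrite mulrCA; apply: rZ.
  by move=> {}b ibt; apply: mem_span => //; apply/allpairsP; exists (a, b).
exists r; split.
  by exists (y * w); rewrite ?mulf_neq0 //; apply/allpairsP; exists (y, w).
move=> x v xzs Hv; case: (mr) => r0 rD rZ.
apply: (span_min (I := [set v | span D r (x * v)])) Hv => /=.
  split=> /=; first by rewrite mulr0.
    by move=> *; rewrite mulrDr; apply: rD.
  by move=> *; rewrite mulrCA; apply: rZ.
move=> _ /allpairsP[[a b] /= [ias ibt ->]].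
move: xzs; rewrite inE => /orP[/eqP->|xzs].
  by rewrite mulrCA; apply: prod; [apply: mem_span|apply: Ht].
by rewrite mulrA; apply: prod; [apply: Hs => //; apply: mem_span|apply: mem_span].
Qed.

Lemma integral_subring D : subring D -> subring (integral_elt D).
Proof.
move=> sD; have mD s := span_submod s sD.
have D1 : integral_elt D 1.
  exists [:: 1]; split; first by exists 1; rewrite ?inE ?oner_neq0.
  by move=> y y1; rewrite mul1r; apply: mem_span.
split=> //; split.
- exists [:: 1]; split; first by exists 1; rewrite ?inE ?oner_neq0.
  by move=> y y1; rewrite mul0r; case: (mD [:: 1]).
- move=> x y Hx Hy; have [|s [nz Hs]] := @integral_common D [:: x; y] sD.
    by move=> z; rewrite !inE => /orP[] /eqP ->.
  exists s; split => // z zs; rewrite mulrBl.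
  by apply: (submodB sD) => //; apply: Hs; rewrite ?inE ?eqxx ?orbT //;
    apply: mem_span.
- move=> x y Hx Hy; have [|s [nz Hs]] := @integral_common D [:: x; y] sD.
    by move=> z; rewrite !inE => /orP[] /eqP ->.
  exists s; split => // z zs; rewrite -mulrA.
  apply: (Hs); rewrite ?inE ?eqxx //.
  by apply: Hs; rewrite ?inE ?eqxx ?orbT //; apply: mem_span.
Qed.

Lemma sub_integral D : subring D -> D `<=` integral_elt D.
Proof.
move=> sD x Dx; exists [:: 1]; split.
  by exists 1; rewrite ?inE ?oner_neq0.
move=> y y1; case: (span_submod [:: 1] sD) => _ _; apply=> //.
exact: mem_span.
Qed.

Lemma integral_eltS D B : D `<=` B -> integral_elt D `<=` integral_elt B.
Proof.
move=> DB x [s [nz Hs]]; exists s; split => // y ys.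
exact/(span_coefS DB)/Hs.
Qed.

(** A finitely generated module S stable under all of zs satisfies S = 1 S inside L S, so the
    determinant trick applies. For a proper ideal L of D this is lying over: L does not generate the
    unit ideal in an integral extension. *)
Lemma integral_nakayama D L zs : subring D -> rng L ->
    (forall d l, D d -> L l -> L (d * l)) ->
    (forall z, z \in zs -> integral_elt D z) -> span L zs 1 -> L 1.
Proof.
move=> sD rL DL Hz [l [Ll E]].
have [s [nz Hs]] := integral_common sD Hz.
apply: (nakayama rL nz) => x xs.
have -> : x = \sum_(i < size zs) l i * (zs`_i * x).
  rewrite -[LHS]mul1r E mulr_suml.
  by apply: eq_bigr => i _; rewrite mulrA.
apply: big_ind.
- exists (fun=> 0); split=> [i|]; first exact: rng0.
  by rewrite big1 // => i _; rewrite mul0r.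
- move=> a b [c [Ac ->]] [d [Ad ->]]; exists (fun i => c i + d i).
  split=> [i|]; first exact: rngD.
  by rewrite -big_split; apply: eq_bigr => i _; rewrite mulrDl.
move=> i _; have [|c [Dc ->]] := Hs zs`_i x _ (mem_span sD xs).
  exact: mem_nth.
exists (fun j => l i * c j); split=> [j|]; first by rewrite mulrC; apply: DL.
by rewrite mulr_sumr; apply: eq_bigr => j _; rewrite mulrA.
Qed.

End Modules.

(** * Finitely stable rings, maximal ideals, localization *)

Section Quadratic.
Variable K : fieldType.
Implicit Types (A B D I J L M N V : set K) (s : seq K).

(* (I : I^2), which is (E : I) for E = (I : I). *)
Definition self_inverse I : set K :=
  [set u | forall x y, I x -> I y -> I (u * x * y)].

(** For I = D s this says that 1 lies in I (I : I^2), so that I is invertible over (I : I). Since (I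
    : I^2) is a D-module, its elements can serve as the coefficients of the generators. *)
Definition finitely_stable D : Prop := forall s,
  (exists2 x, x \in s & x != 0) -> span (self_inverse (span D s)) s 1.

(** As 1 lies in the module, u v x y can be read as u (v x y) 1. *)
Lemma self_inverse_rng D s : subring D -> span D s 1 ->
  rng (self_inverse (span D s)).
Proof.
move=> sD I1; have mI := span_submod s sD; split.
- by move=> x y _ _; rewrite !mul0r; case: mI.
- move=> u v Hu Hv x y Ix Iy; rewrite !mulrBl.
  by apply: (submodB sD) => //; [apply: Hu|apply: Hv].
- move=> u v Hu Hv x y Ix Iy.
  have := Hu _ _ (Hv _ _ Ix Iy) I1.
  by rewrite mulr1 !mulrA.
Qed.

(** Let J = D + Dx + Dy and U = (J : J^2). Stability puts 1 in U J, and U is closed under products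
    because 1 is in J. The generators of J are integral over D, so lying over gives 1 in U, that is,
    J J inside J. *)
Lemma integral_module_mul D I x y : subring D -> finitely_stable D ->
  submodule D I -> I 1 -> I `<=` integral_elt D -> I x -> I y -> I (x * y).
Proof.
move=> sD fs mI I1 sub Ix Iy; pose s := [:: 1; x; y].
have ms := span_submod s sD.
have s1 : span D s 1 by apply: mem_span => //; rewrite inE eqxx.
have U1 : self_inverse (span D s) 1.
  apply: (@integral_nakayama _ D _ s) => //.
  - exact: self_inverse_rng.
  - move=> d l Dd Hl a b Ia Ib; rewrite -!mulrA.
    by case: ms => _ _; apply => //; rewrite mulrA; apply: Hl.
  - by move=> z; rewrite !inE => /or3P[] /eqP ->; apply: sub.
  - by apply: fs; exists 1; rewrite ?oner_neq0 // inE eqxx.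
have sI : span D s `<=` I.
  by apply: span_min => // z; rewrite !inE => /or3P[] /eqP ->.
apply: sI; rewrite -[x]mul1r; apply: U1; apply: mem_span => //;
  by rewrite !inE eqxx ?orbT.
Qed.

Lemma integral_quadratic D x : subring D -> finitely_stable D ->
  integral_elt D x -> exists r t, [/\ D r, D t & x ^+ 2 = r + t * x].
Proof.
move=> sD fs Hx; have [rB B1] := integral_subring sD.
have : span D [:: 1; x] (x * x).
  apply: (integral_module_mul sD fs (span_submod _ sD)).
  - by apply: mem_span => //; rewrite inE eqxx.
  - apply: span_min => [|z].
      exact: subring_submod (integral_subring sD) (sub_integral sD).
    by rewrite !inE => /orP[] /eqP ->.
  - by apply: mem_span => //; rewrite !inE eqxx orbT.
  - by apply: mem_span => //; rewrite !inE eqxx orbT.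
by move=> /span2P[r [t [Dr Dt E]]]; exists r, t; rewrite expr2 E mulr1.
Qed.

(* Ideals in the usual sense, allowing 0 but not the whole ring. *)
Record proper_ideal B N : Prop := ProperIdeal {
  pideal_sub : N `<=` B;
  pideal_rng : rng N;
  pidealM : forall x y, B x -> N y -> N (x * y);
  pideal1 : ~ N 1 }.

Definition prime_ideal B N : Prop :=
  proper_ideal B N /\ forall x y, B x -> B y -> N (x * y) -> N x \/ N y.

(** Stated as B/N being a field, the form in which maximality is used. *)
Definition maximal_ideal B N : Prop :=
  proper_ideal B N /\ forall x, B x -> ~ N x -> exists2 y, B y & N (1 - x * y).

Definition local_ring D M : Prop :=
  [/\ subring D, proper_ideal D M & forall x, D x -> ~ M x -> D x^-1].

Lemma pidealMr B N x y : proper_ideal B N -> B x -> N y -> N (y * x).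
Proof. by move=> pN Bx Ny; rewrite mulrC; apply: (pidealM pN). Qed.

Lemma maximal_prime B N : maximal_ideal B N -> prime_ideal B N.
Proof.
move=> [pN mN]; split => // x y Bx By Nxy.
have [Nx|Nx] := pselect (N x); [by left|right].
have [z Bz Nz] := mN x Bx Nx.
have -> : y = y * (1 - x * z) + z * (x * y) by ring.
apply: (rngD (pideal_rng pN)); first exact: (pidealM pN).
exact: (pidealM pN).
Qed.

Lemma proper_ideal0 B : subring B -> proper_ideal B [set 0].
Proof.
move=> [rB B1]; split.
- by move=> _ ->; apply: rng0.
- split=> // [x y ->->|x y ->->]; first by rewrite /= subr0.
  by rewrite /= mul0r.
- by move=> x y _ ->; rewrite /= mulr0.
- by move/eqP; rewrite oner_eq0.
Qed.

(** Zorn's lemma is applied to the sets whose union with L is a proper ideal, so that the empty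
    chain, with empty union, is also admissible. *)
Lemma exists_maximal B L : subring B -> proper_ideal B L ->
  exists2 N, maximal_ideal B N & L `<=` N.
Proof.
move=> [rB B1] pL.
have [F chain tot|X [pX mX]] :=
    @Zorn_bigcup K (fun X => proper_ideal B (L `|` X)).
  have [F0|[X0 FX0]] : (forall X, ~ F X) \/ exists X, F X.
  - by have [|n] := pselect (exists X, F X); [right|left => X FX; apply: n; exists X].
  - rewrite (_ : L `|` _ = L) //; apply/seteqP; split => [x [|[X /F0]]//|x]; by left.
  have dir x y : (L `|` \bigcup_(X in F) X) x -> (L `|` \bigcup_(X in F) X) y ->
      exists2 X, F X & (L `|` X) x /\ (L `|` X) y.
    move=> [Lx|[X FX Xx]] [Ly|[Y FY Yy]].
    - by exists X0 => //; split; left.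
    - by exists Y => //; split; [left|right].
    - by exists X => //; split; [right|left].
    - have [XY|YX] := tot _ _ FX FY.
        by exists Y => //; split; right => //; apply: XY.
      by exists X => //; split; right => //; apply: YX.
  have incl X x : F X -> (L `|` X) x -> (L `|` \bigcup_(X in F) X) x.
    by move=> FX [Lx|Xx]; [left|right; exists X].
  split.
  - move=> x Hx; have [X /chain pX [Xx _]] := dir _ _ Hx Hx.
    exact: (pideal_sub pX).
  - split.
    + by left; exact: rng0 (pideal_rng pL).
    + move=> x y Hx Hy; have [X FX [Xx Xy]] := dir _ _ Hx Hy.
      by apply: (incl X) => //; exact: (rngB (pideal_rng (chain _ FX)) Xx Xy).
    + move=> x y Hx Hy; have [X FX [Xx Xy]] := dir _ _ Hx Hy.
      by apply: (incl X) => //; exact: (rngM (pideal_rng (chain _ FX)) Xx Xy).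
  - move=> x y Bx Hy; have [X FX [Xy _]] := dir _ _ Hy Hy.
    by apply: (incl X) => //; apply: (pidealM (chain _ FX)).
  - move=> H1; have [X /chain pX [X1 _]] := dir _ _ H1 H1.
    exact: (pideal1 pX X1).
exists (L `|` X); last by move=> x; left.
split=> // x Bx Nx; apply: contrapT => H.
pose Y := [set z | exists a b, [/\ (L `|` X) a, B b & z = a + b * x]].
have LY : L `|` X `<=` Y.
  move=> a La; exists a, 0; split=> //; first exact: rng0.
  by rewrite mul0r addr0.
have XY : L `|` Y = Y.
  by apply/seteqP; split => [z [Lz|//]|z]; [apply: LY; left|right].
apply: (mX Y).
  split; first by move=> z Xz; apply: LY; right.
  move=> YX; apply: Nx; right; apply: YX; exists 0, 1; split => //.
    exact: rng0 (pideal_rng pX).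
  by rewrite mul1r add0r.
rewrite XY; split.
- move=> _ [a [b [La Bb ->]]]; apply: rngD => //; last exact: rngM.
  exact: (pideal_sub pX).
- have rX := pideal_rng pX.
  have Ym y z : B y -> Y z -> Y (y * z).
    move=> By [a [b [La Bb ->]]]; exists (y * a), (y * b).
    by rewrite mulrDr mulrA; split => //; [apply: (pidealM pX)|apply: rngM].
  have YB : Y `<=` B.
    move=> _ [a [b [La Bb ->]]]; apply: rngD => //; last exact: rngM.
    exact: (pideal_sub pX).
  split.
  + by apply: LY; apply: rng0.
  + move=> _ _ [a [b [La Bb ->]]] [c [d [Lc Bd ->]]].
    exists (a - c), (b - d); split; [exact: rngB|exact: rngB|ring].
  + by move=> y z /YB By Yz; apply: Ym.
- move=> y _ By [a [b [La Bb ->]]]; exists (y * a), (y * b).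
  by rewrite mulrDr mulrA; split => //; [apply: (pidealM pX)|apply: rngM].
- move=> [a [b [La Bb E]]]; apply: H; exists b => //.
  by rewrite E mulrC addrK.
Qed.

Lemma prime_neq0 B N x : prime_ideal B N -> ~ N x -> x != 0.
Proof.
by move=> [pN _]; apply: contra_notN => /eqP->; exact: rng0 (pideal_rng pN).
Qed.

Lemma primeM B N x y : prime_ideal B N -> B x -> B y -> ~ N x -> ~ N y -> ~ N (x * y).
Proof. by move=> [_ pr] Bx By nx ny /pr[]. Qed.

Lemma primeX B N x n : subring B -> prime_ideal B N -> B x -> N (x ^+ n) -> N x.
Proof.
move=> sB [pN pr] Bx; elim: n => [|n IH].
  by rewrite expr0 => /(pideal1 pN).
by rewrite exprS => /pr[]//; apply: subringX.
Qed.

Lemma sub_localize B I N : subring B -> prime_ideal B N -> I `<=` localize B I N.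
Proof.
move=> [_ B1] [pN _] x Ix; exists x, 1; split => //; first exact: (pideal1 pN).
by rewrite divr1.
Qed.

Lemma localizeS B I J N : I `<=` J -> localize B I N `<=` localize B J N.
Proof. by move=> IJ _ [x [t [Ix Bt Nt ->]]]; exists x, t; split => //; apply: IJ. Qed.

Lemma localizeP B I N z : submodule B I -> prime_ideal B N ->
  localize B I N z <-> exists t, [/\ B t, ~ N t & I (t * z)].
Proof.
move=> mI pr; split=> [[x [t [Ix Bt Nt ->]]]|[t [Bt Nt It]]].
  by exists t; rewrite mulrC divfK //; exact: prime_neq0 pr Nt.
exists (t * z), t; split => //; rewrite mulrC mulKf //.
exact: prime_neq0 pr Nt.
Qed.

Lemma localize_submod B I N : subring B -> prime_ideal B N -> submodule B I ->
  submodule (localize B B N) (localize B I N).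
Proof.
move=> sB pr mI; have [rB B1] := sB; case: (mI) => I0 ID IZ; split.
- exact: sub_localize.
- move=> _ _ [x [t [Ix Bt Nt ->]]] [y [u [Iy Bu Nu ->]]].
  exists (u * x + t * y), (t * u); split.
  + by apply: ID; apply: IZ.
  + exact: rngM.
  + exact: (primeM pr Bt Bu Nt Nu).
  have t0 := prime_neq0 pr Nt; have u0 := prime_neq0 pr Nu; field.
  by rewrite t0 u0.
- move=> _ _ [x [t [Ix Bt Nt ->]]] [y [u [Iy Bu Nu ->]]].
  exists (x * y), (t * u); split.
  + exact: IZ.
  + exact: rngM.
  + exact: (primeM pr Bt Bu Nt Nu).
  by rewrite mulf_div.
Qed.

Lemma pideal_submod B N : proper_ideal B N -> submodule B N.
Proof.
move=> pN; split; [exact: rng0 (pideal_rng pN)| |exact: pidealM].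
by move=> x y; exact: rngD (pideal_rng pN).
Qed.

Lemma localize_subring B N : subring B -> prime_ideal B N ->
  subring (localize B B N).
Proof.
move=> sB pr; have mB := localize_submod sB pr (submod_self sB).
case: (mB) => L0 LD LM.
have sub := @sub_localize B B N sB pr; have [rB B1] := sB.
split; last exact: sub.
split=> // x y Lx Ly; apply: LD => //; rewrite -mulN1r; apply: LM => //.
by apply: sub; apply: rngN.
Qed.

Lemma localize_local B N : subring B -> prime_ideal B N ->
  local_ring (localize B B N) (localize B N N).
Proof.
move=> sB pr; have [pN prN] := pr.
have sL := localize_subring sB pr.
have [L0 LD LM] := localize_submod sB pr (pideal_submod pN).
have sub : localize B N N `<=` localize B B N.
  exact: localizeS (pideal_sub pN).
split=> //.
- split=> //.
  + split=> // x y Nx Ny; last by apply: LM => //; apply: sub.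
    apply: LD => //; rewrite -mulN1r; apply: LM => //.
    by apply: rngN; case: sL.
  + move=> [x [t [Nx Bt Nt E]]]; apply: (Nt).
    by rewrite -[t]mul1r E divfK //; exact: prime_neq0 pr Nt.
- move=> _ [x [t [Bx Bt Nt ->]]] H; exists t, x; split => //.
  - by move=> Nx; apply: H; exists x, t.
  - by rewrite invf_div.
Qed.

Lemma local_unit D M x : local_ring D M -> D x -> D x^-1 -> x != 0 -> ~ M x.
Proof.
move=> [sD pM _] Dx DV x0 Mx; apply: (pideal1 pM).
by rewrite -(mulVf x0); apply: (pidealM pM).
Qed.

Lemma local_neq0 D M x : local_ring D M -> ~ M x -> x != 0.
Proof.
by move=> [_ pM _]; apply: contra_notN => /eqP->; exact: rng0 (pideal_rng pM).
Qed.

Lemma local_sub1 D M x : local_ring D M -> M x -> ~ M (1 - x).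
Proof.
move=> [_ pM _] Mx M1; apply: (pideal1 pM).
by rewrite -(subrK x 1); apply: (rngD (pideal_rng pM)).
Qed.
End Quadratic.

(** * Divisorial ideals and discrete valuations *)

Section Divisorial.
Variable K : fieldType.
Implicit Types (A D I J X : set K) (s : seq K).

Lemma acc_max (C G : set K -> Prop) : acc C -> (forall I, G I -> C I) ->
  (exists I, G I) -> exists I, G I /\ forall J, G J -> I `<=` J -> J = I.
Proof.
move=> accC GC [I0 GI0]; apply: contrapT => H.
have /choice[f Hf] (I : set K) : exists J, G I -> [/\ G J, I `<=` J & J <> I].
  have [GI|nGI] := pselect (G I); last by exists I.
  apply: contrapT => HI; apply: H; exists I; split=> // J GJ IJ.
  by apply: contrapT => nJI; apply: HI; exists J.
pose F n := iter n f I0.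
have GF n : G (F n) by elim: n => //= n /Hf[].
have [||N /(_ N.+1 (leqnSn N)) E] := accC F.
- by move=> n; apply: GC.
- by move=> n; have [] := Hf _ (GF n).
- by have [_ _] := Hf _ (GF N); apply.
Qed.

Lemma colonS A X I : X `<=` I -> colon A I `<=` colon A X.
Proof. by move=> XI x Hx y /XI; apply: Hx. Qed.

Lemma v_op_sub A I : I `<=` v_op A I.
Proof. by move=> x Ix y Hy; rewrite mulrC; apply: Hy. Qed.

Lemma v_opS A I J : I `<=` J -> v_op A I `<=` v_op A J.
Proof. by move=> IJ; do 2 apply: colonS. Qed.

Lemma v_op_colon A X : v_op A (colon A X) = colon A X.
Proof. by apply/seteqP; split; [apply: colonS; apply: v_op_sub|apply: v_op_sub]. Qed.

Lemma v_op_idem A I : v_op A (v_op A I) = v_op A I.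
Proof. exact: v_op_colon. Qed.

Lemma v_op_min A I J : I `<=` J -> v_op A J = J -> v_op A I `<=` J.
Proof. by move=> IJ <-; apply: v_opS. Qed.

Lemma colon_submod A X : subring A -> submodule A (colon A X).
Proof.
move=> [rA A1]; split.
- by move=> y _; rewrite mul0r; apply: rng0.
- by move=> x y Hx Hy z Xz; rewrite mulrDl; apply: rngD => //; [apply: Hx|apply: Hy].
- by move=> a x Aa Hx z Xz; rewrite -mulrA; apply: rngM => //; apply: Hx.
Qed.

Lemma v_op_ring A : subring A -> v_op A A = A.
Proof.
move=> [rA A1]; suff E : A = colon A [set 1] by rewrite {2}E v_op_colon -E.
apply/seteqP; split => x; first by move=> Ax y ->; rewrite mulr1.
by move=> /(_ 1 erefl); rewrite mulr1.
Qed.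

(* [mori A] is convertible to [acc (divisorial A)]. *)
Definition divisorial A I : Prop := integral_ideal A I /\ v_op A I = I.

Lemma integral_idealP A I : subring A -> submodule A I -> I `<=` A ->
  (exists2 x, I x & x != 0) -> integral_ideal A I.
Proof.
move=> sA mI IA nz; split => //; split => //; exists 1.
by case: sA => rA A1; split; [|exact: oner_neq0|move=> x /IA; rewrite mul1r].
Qed.

Lemma divisorial_colon A X : subring A -> colon A X `<=` A ->
  (exists2 x, colon A X x & x != 0) -> divisorial A (colon A X).
Proof.
move=> sA sub nz; split; last exact: v_op_colon.
by apply: integral_idealP => //; apply: colon_submod.
Qed.

(** Were all c/m^k in D, the principal ideals (c/m^k) D would form an ascending chain, and its
    stopping would put m^-1 in D. They are written as colons, which shows them to be divisorial. *)
Lemma mori_archimedean D m c : subring D -> mori D ->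
  D m -> m != 0 -> ~ D m^-1 -> D c -> c != 0 -> exists k, ~ D (c / m ^+ k).
Proof.
move=> sD accD Dm m0 mV Dc c0; apply: contrapT => H.
have {}H k : D (c / m ^+ k) by apply: contrapT => n; apply: H; exists k.
have [rD D1] := sD; have mk0 k : m ^+ k != 0 by rewrite expf_neq0.
pose I k := colon D [set m ^+ k / c].
have [||N /(_ N.+1 (leqnSn N)) E] := accD I.
- move=> k; apply: divisorial_colon => //.
    move=> x /(_ _ erefl) /(rngM rD (H k)).
    by rewrite (_ : c / m ^+ k * _ = x) //; field; rewrite c0 mk0.
  by exists c => // _ ->; rewrite mulrC divfK //; apply: subringX.
- move=> k x Hx _ ->; rewrite exprS.
  have := rngM rD Dm (Hx _ erefl).
  by rewrite (_ : m * (x * _) = x * (m * m ^+ k / c)) //; ring.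
- have : I N.+1 (c / m ^+ N.+1).
    by move=> _ ->; rewrite mulf_div [X in X / _]mulrC divff ?mulf_neq0.
  rewrite E => /(_ _ erefl).
  rewrite (_ : c / m ^+ N.+1 * (m ^+ N / c) = m^-1) //.
  by rewrite exprS; field; rewrite c0 m0 mk0.
Qed.

(** Among the v-closures of finitely generated subideals of I there is a maximal one; adding any
    element of I to its generators cannot enlarge it. *)
Lemma mori_fin_gen D I : subring D -> mori D -> integral_ideal D I ->
  exists s, [/\ exists2 x, x \in s & x != 0, forall x, x \in s -> I x &
    I `<=` v_op D (span D s)].
Proof.
move=> sD accD [[mI [x0 Ix0 nz] _] ID].
pose G X := exists s, [/\ exists2 x, x \in s & x != 0,
  forall x, x \in s -> I x & X = v_op D (span D s)].
have [||X [[s [snz Is EX]] mX]] := @acc_max (fun I => divisorial D I) G accD.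
- move=> _ [s [[x xs xnz] Is ->]]; apply: divisorial_colon => //.
    apply: v_op_min; last exact: v_op_ring.
    by apply: span_min => [|y ys]; [apply: submod_self|apply: ID; apply: Is].
  by exists x => //; apply: v_op_sub; apply: mem_span.
- exists (v_op D (span D [:: x0])), [:: x0]; split=> //.
    by exists x0; rewrite // inE.
  by move=> x; rewrite inE => /eqP->.
exists s; split => // x Ix; rewrite -EX.
have <- : v_op D (span D (x :: s)) = X.
  apply: mX.
    exists (x :: s); split => //.
      by case: snz => y ys y0; exists y; rewrite // inE ys orbT.
    by move=> y; rewrite inE => /orP[/eqP->|/Is].
  rewrite EX; apply: v_opS; apply: span_min => [|y ys]; first exact: span_submod.
  by apply: mem_span => //; rewrite inE ys orbT.
by apply: v_op_sub; apply: mem_span => //; rewrite inE eqxx.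
Qed.

End Divisorial.

Section Valuation.
Variable K : fieldType.
Implicit Types (V P I : set K).

Definition valuation V P : Prop :=
  local_ring V P /\ forall x, x != 0 -> V x \/ V x^-1.

Definition generates V (f : K) I : Prop :=
  [/\ f != 0, I f & forall x, I x -> V (x / f)].

Lemma div_chain (x y z : K) : y != 0 -> x / z = x / y * (y / z).
Proof. by move=> y0; rewrite mulrA divfK. Qed.

(** If neither f nor g works for both rings, f + g does: g/f is a nonunit of V1, so f + g is f times
    a unit there, and symmetrically for g in V2. *)
Lemma common_generator V1 P1 V2 P2 I f g : local_ring V1 P1 -> local_ring V2 P2 ->
    (forall x y, I x -> I y -> I (x + y)) ->
    generates V1 f I -> generates V2 g I ->
  exists2 h, generates V1 h I & generates V2 h I.
Proof.
move=> l1 l2 ID [f0 If Hf] [g0 Ig Hg].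
have [[r1 _] _ u1] := l1; have [[r2 _] _ u2] := l2.
have [H2|H2] := pselect (V2 (g / f)).
  exists f; split => // x Ix.
  by rewrite (div_chain _ _ g0); apply: rngM => //; apply: Hg.
have [H1|H1] := pselect (V1 (f / g)).
  exists g; split => // x Ix.
  by rewrite (div_chain _ _ f0); apply: rngM => //; apply: Hf.
have unit V P a b : local_ring V P -> a != 0 -> b != 0 -> V (b / a) -> ~ V (a / b) ->
    a + b != 0 /\ V (a / (a + b)).
  move=> l a0 b0 Vba nVab; have [[rV _] pP u] := l.
  have Pba : P (b / a).
    by apply: contrapT => /(u _ Vba); rewrite invf_div.
  have nP : ~ P (1 - - (b / a)).
    by apply: (local_sub1 l); apply: rngN => //; apply: pideal_rng pP.
  have E : a + b = a * (1 - - (b / a)) by field.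
  have n0 := local_neq0 l nP.
  split; first by rewrite E mulf_neq0.
  rewrite E invfM mulrA divff // mul1r; apply: u => //.
  by apply: rngB; rewrite ?opprK //; [case: l => [[]]|apply: rngN].
have [n0 V1h] := unit _ _ _ _ l1 f0 g0 (Hf _ Ig) H1.
have [_ V2h] := unit _ _ _ _ l2 g0 f0 (Hg _ If) H2.
rewrite addrC in V2h.
exists (f + g); split => // [|x Ix]; try exact: ID.
- by rewrite (div_chain _ _ f0); apply: rngM => //; apply: Hf.
- by rewrite (div_chain _ _ g0); apply: rngM => //; apply: Hg.
Qed.

Lemma ex_min_prop (Q : nat -> Prop) : (exists n, Q n) ->
  exists2 n, Q n & forall k, (k < n)%N -> ~ Q k.
Proof.
move=> [n]; elim/ltn_ind: n => n IH Qn.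
have [[k lt Qk]|H] := pselect (exists2 k, (k < n)%N & Q k); first exact: IH Qk.
by exists n => // k lt Qk; apply: H; exists k.
Qed.

(* The bound on squares makes the maximal ideal principal. *)
Lemma valuation_uniformizer V P m : valuation V P -> P m -> m != 0 ->
  (forall n, P n -> V (n ^+ 2 / m)) -> exists p, generates V p P.
Proof.
move=> [lV tot] Pm m0 sq; have [[rV V1] pP u] := lV.
have [H|] := pselect (forall n, P n -> V (n / m)); first by exists m.
move=> /existsNP[n /not_implyP[Pn nV]].
have n0 : n != 0 by apply: contra_notN nV => /eqP->; rewrite mul0r; apply: rng0.
exists n; split=> // n' Pn'; apply: contrapT => nV'.
have n'0 : n' != 0.
  by apply: contra_notN nV' => /eqP->; rewrite mul0r; apply: rng0.
have quo a b : a != 0 -> b != 0 -> ~ V (a / b) -> P (b / a).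
  move=> a0 b0 nab; apply: contrapT => nP.
  have [//|] := tot (a / b) (mulf_neq0 a0 (invr_neq0 b0)).
  by rewrite invf_div => /u/(_ nP); rewrite invf_div.
have Pt := quo _ _ n0 m0 nV; have Pt' := quo _ _ n'0 n0 nV'.
(* Now m = n' (n/n') (m/n) is a product of three elements of P; the bound on squares, applied to
   each factor, puts m^2/m^3 in V. *)
have := rngM rV (sq _ Pn') (rngM rV (sq _ Pt') (sq _ Pt)).
have -> : n' ^+ 2 / m * ((n / n') ^+ 2 / m * ((m / n) ^+ 2 / m)) = m^-1.
  by field; rewrite n0 n'0 m0.
by move=> Vm; apply: (local_unit lV (pideal_sub pP Pm) Vm m0 Pm).
Qed.

(** Divide a nonzero element of V by p as long as the quotient stays in V: by the last hypothesis
    this stops, and it stops at a unit. The exponent is unique because p is not a unit; it is the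
    valuation. *)
Lemma uniformizer_dvr V P p : valuation V P -> generates V p P ->
  (forall a, a != 0 -> exists k, ~ V (a / p ^+ k)) -> dvr V.
Proof.
move=> [lV tot] [p0 Pp gen] arch; have [sV pP u] := lV; have [rV V1] := sV.
have Vp : V p by apply: (pideal_sub pP).
have pz0 (n : int) : p ^ n != 0 by rewrite expfz_neq0.
have step x : x != 0 -> V x ->
    exists n : nat, V (x / p ^+ n) /\ V (x / p ^+ n)^-1.
  move=> x0 Vx; have [[|k] nk min] := ex_min_prop (arch x x0).
    by move: nk; rewrite expr0 divr1.
  have Vk : V (x / p ^+ k) by apply: contrapT; apply: min.
  exists k; split=> //; apply: u => // /gen; rewrite -mulrA -invfM.
  by rewrite -exprSr.
pose unit x := V x /\ V x^-1.
have unitV x : unit x -> unit x^-1 by rewrite /unit invrK => -[].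
have unitM x y : unit x -> unit y -> unit (x * y).
  by move=> [? ?] [? ?]; split; rewrite ?invfM; apply: rngM.
have ex x : x != 0 -> exists n : int, unit (x / p ^ n).
  move=> x0; have [Vx|Vx] := tot x x0.
    by have [n Hn] := step x x0 Vx; exists n%:Z.
  have [n Hn] := step x^-1 (invr_neq0 x0) Vx.
  exists (- n%:Z); move/unitV: Hn.
  by rewrite invfM !invrK -invr_expz invrK.
have /choice[v Hv] x : exists n : int, x != 0 -> unit (x / p ^ n).
  by have [->|/ex[n Hn]] := eqVneq x 0; [exists 0|exists n].
have pos (n : int) : unit (p ^ n) -> n <= 0.
  case: n => [[//|n]|//] [_ Hn]; exfalso.
  apply: (local_unit lV Vp _ p0 Pp).
  have := rngM rV (subringX n sV Vp) Hn.
  rewrite (_ : _ * _ = p^-1) //; rewrite -exprnP exprSr.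
  by field; rewrite p0 expf_neq0.
have uniq x (n : int) : x != 0 -> unit (x / p ^ n) -> v x = n.
  move=> x0 un; have uv := Hv x x0.
  have E (a b : int) : unit (x / p ^ a) -> unit (x / p ^ b) -> a <= b.
    move=> ua ub; rewrite -subr_le0; apply: pos.
    have := unitM _ _ (unitV _ ua) ub.
    rewrite (_ : (x / p ^ a)^-1 * (x / p ^ b) = p ^ (a - b)) //.
    by rewrite expfzDr // -invr_expz; field; rewrite x0 !pz0.
  by apply/eqP; rewrite eq_le !E.
have VE x : x != 0 -> V x <-> 0 <= v x.
  move=> x0; have [Hx _] := Hv x x0; split=> [Vx|].
    by have [n Hn] := step x x0 Vx; rewrite (uniq x n%:Z).
  case: (v x) Hx => // n Hx _; rewrite -(divfK (pz0 n%:Z) x).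
  by apply: rngM => //; apply: subringX.
exists v; last first.
  apply/seteqP; split=> x.
    by move=> Vx; have [|x0] := eqVneq x 0; [left|right; apply/VE].
  by move=> [->|v0]; [apply: rng0|have [->|x0] := eqVneq x 0;
    [apply: rng0|apply/VE]].
have vM x y : x != 0 -> y != 0 -> v (x * y) = v x + v y.
  move=> x0 y0; apply: uniq; first exact: mulf_neq0.
  have := unitM _ _ (Hv x x0) (Hv y y0).
  by rewrite mulf_div expfzDr.
have vp (n : int) : v (p ^ n) = n.
  by apply: uniq => //; rewrite divff //; split; rewrite ?invr1.
split=> // [x y x0 y0 xy0|n]; last by exists (p ^ n).
pose n := Num.min (v x) (v y).
have Vn z : z != 0 -> V (z / p ^ n) <-> n <= v z.
  move=> z0; rewrite VE ?mulf_neq0 ?invr_neq0 // vM ?invr_neq0 //.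
  by rewrite -[_^-1]invrK invr_expz invrK vp subr_ge0.
apply/(Vn _ xy0); rewrite mulrDl; apply: rngD => //; apply/Vn => //.
  by rewrite /n ge_min lexx.
by rewrite /n ge_min lexx orbT.
Qed.

End Valuation.

(** * Local Mori domains *)

Section LocalMori.
Variables (K : fieldType) (D M : set K).
Hypothesis lD : local_ring D M.
Hypothesis fsD : finitely_stable D.
Hypothesis fracD : forall z, exists x y, [/\ D x, D y, y != 0 & z = x / y].

Let sD : subring D. Proof. by case: lD. Qed.
Let rD : rng D. Proof. by case: sD. Qed.
Let D1 : D 1. Proof. by case: sD. Qed.
Let pM : proper_ideal D M. Proof. by case: lD. Qed.
Let rM : rng M := pideal_rng pM.
Let uD x : D x -> ~ M x -> D x^-1. Proof. by case: lD => _ _; apply. Qed.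

Local Notation B := (integral_elt D).
Local Notation loc N := (localize B B N).

Let sB : subring B := integral_subring sD.
Let rB : rng B. Proof. by case: sB. Qed.
Let B1 : B 1. Proof. by case: sB. Qed.
Let DB : D `<=` B := sub_integral sD.
Let MD : M `<=` D := pideal_sub pM.

Let quadratic x : B x -> exists r t, [/\ D r, D t & x ^+ 2 = r + t * x].
Proof. exact: integral_quadratic. Qed.

(** Otherwise 1 - m z is in N for some z in B with z^2 = r + t z. Its norm, the product with 1 - m
    (t - z), is 1 - m t - m^2 r, a unit of D that would lie in N. *)
Lemma maximal_over N m : maximal_ideal B N -> M m -> N m.
Proof.
move=> [pN mN] Mm; apply: contrapT => nN.
have [z Bz Nz] := mN m (DB (MD Mm)) nN.
have [r [t [Dr Dt E]]] := quadratic Bz.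
have Mc : M (m * t + m ^+ 2 * r).
  by apply: rngD => //; rewrite ?expr2 -?mulrA; apply: (pidealMr pM) => //;
    apply: rngM => //; apply: MD.
have nM := local_sub1 lD Mc.
have Du : D (1 - (m * t + m ^+ 2 * r)).
  by apply: rngB => //; apply: MD.
apply: (pideal1 pN).
rewrite -(mulVf (local_neq0 lD nM)); apply: (pidealM pN).
  exact/DB/uD.
have -> : 1 - (m * t + m ^+ 2 * r) = (1 - m * t + m * z) * (1 - m * z).
  have -> : m ^+ 2 * r = m ^+ 2 * (z ^+ 2 - t * z) by rewrite E addrK.
  ring.
apply: (pidealM pN) => //; have Bm := DB (MD Mm).
by apply: rngD; [|apply: rngB; [| |apply: rngM; [| |apply: DB]]|apply: rngM].
Qed.

Lemma maximal_contract N x : maximal_ideal B N -> D x -> N x -> M x.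
Proof.
move=> [pN _] Dx Nx; apply: contrapT => nM; apply: (pideal1 pN).
rewrite -(mulVf (local_neq0 lD nM)); apply: (pidealM pN) => //.
exact/DB/uD.
Qed.

Lemma self_inverse_integral s u x : (exists2 y, y \in s & y != 0) ->
  self_inverse (span D s) u -> x \in s -> B (u * x).
Proof.
move=> nz Hu xs; exists s; split=> // y ys.
by apply: Hu; apply: mem_span.
Qed.

Lemma two_generated_stable x y : x != 0 \/ y != 0 -> exists u v,
  [/\ u * x + v * y = 1, B (u * x), B (u * y), B (v * x) & B (v * y)] /\
  (self_inverse (span D [:: x; y]) u /\ self_inverse (span D [:: x; y]) v).
Proof.
move=> nz; have nzs : exists2 z, z \in [:: x; y] & z != 0.
  by case: nz => z0; [exists x|exists y]; rewrite // !inE eqxx ?orbT.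
have /span2P[u [v [Hu Hv E]]] := fsD nzs.
exists u, v; do 2 split=> //; apply: (@self_inverse_integral [:: x; y]) => //;
  by rewrite !inE eqxx ?orbT.
Qed.

(** For x = a/b, stability of D a + D b gives u a + v b = 1 with u a, u b, v a, v b in B. One of u
    a, v b is outside N, and x = v a / (v b), x^-1 = u b / (u a). *)
Lemma localize_valuation N : maximal_ideal B N ->
  valuation (loc N) (localize B N N).
Proof.
move=> mN; have pN := maximal_prime mN; split; first exact: localize_local.
move=> x x0; have [a [b [Da Db b0 xE]]] := fracD x.
have a0 : a != 0 by apply: contraNN x0 => /eqP a0; rewrite xE a0 mul0r.
have [u [v [[E Bua Bub Bva Bvb] _]]] := @two_generated_stable a b (or_introl a0).
have [Nua|nN] := pselect (N (u * a)).
  have nNb : ~ N (v * b).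
    move=> Nvb; case: pN => pN _; apply: (pideal1 pN).
    by rewrite -E; apply: rngD => //; case: pN.
  left; exists (v * a), (v * b); split=> //.
  have v0 : v != 0.
    by have := prime_neq0 pN nNb; rewrite mulf_eq0 negb_or => /andP[].
  by rewrite xE; field; rewrite b0 v0.
right; exists (u * b), (u * a); split=> //.
have u0 : u != 0.
  by have := prime_neq0 pN nN; rewrite mulf_eq0 negb_or => /andP[].
by rewrite xE; field; rewrite b0 a0 u0.
Qed.

Lemma maximal_eq N N' : maximal_ideal B N -> maximal_ideal B N' ->
  N `<=` N' -> N = N'.
Proof.
move=> [pN mN] [pN' _] NN'; apply/seteqP; split=> // x N'x.
apply: contrapT => nN; have Bx := pideal_sub pN' N'x.
have [y By /NN' H] := mN x Bx nN; apply: (pideal1 pN').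
rewrite -(subrK (x * y) 1); apply: rngD => //; first exact: pideal_rng pN'.
exact: (pidealMr pN').
Qed.

Lemma maximal_comax N N' : maximal_ideal B N -> maximal_ideal B N' ->
  N <> N' -> exists e, [/\ B e, N e & N' (1 - e)].
Proof.
move=> mN mN' neq; apply: contrapT => H; apply: neq.
apply: maximal_eq => // x Nx; apply: contrapT => nN'.
have [pN _] := mN; have [_ H'] := mN'; have Bx := pideal_sub pN Nx.
have [y By Hy] := H' x Bx nN'; apply: H; exists (x * y); split=> //.
  exact: rngM.
exact: (pidealMr pN).
Qed.

Lemma maximal_comax2 N N' N'' : maximal_ideal B N -> maximal_ideal B N' ->
    maximal_ideal B N'' -> N <> N' -> N <> N'' ->
  exists e, [/\ B e, N e, N' (1 - e) & N'' (1 - e)].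
Proof.
move=> mN mN' mN'' n1 n2.
have [p [Bp Np N1p]] := maximal_comax mN mN' n1.
have [q [Bq Nq N1q]] := maximal_comax mN mN'' n2.
have [[[pN _] [pN' _]] [pN'' _]] := (mN, mN', mN'').
have Bp1 : B (1 - p) by apply: rngB.
have Bq1 : B (1 - q) by apply: rngB.
have E : 1 - (1 - (1 - p) * (1 - q)) = (1 - p) * (1 - q) by ring.
exists (1 - (1 - p) * (1 - q)); rewrite E; split.
- by apply: rngB => //; apply: rngM.
- have -> : 1 - (1 - p) * (1 - q) = p + q * (1 - p) by ring.
  by apply: (rngD (pideal_rng pN)) => //; apply: (pidealMr pN).
- exact: (pidealMr pN').
- exact: (pidealM pN'').
Qed.

(* Were there three, take x, y congruent to (1, 1, 0), (0, 1, 1) modulo them: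
   (x, y) would not be invertible over its endomorphism ring. *)
Lemma maximal_at_most_two N1 N2 N3 : maximal_ideal B N1 ->
    maximal_ideal B N2 -> maximal_ideal B N3 ->
  N1 <> N2 -> N1 <> N3 -> N2 <> N3 -> False.
Proof.
move=> m1 m2 m3 n12 n13 n23.
have [x [Bx x3 x1 x2]] := maximal_comax2 m3 m1 m2 (nesym n13) (nesym n23).
have [y [By y1 y2 y3]] := maximal_comax2 m1 m2 m3 n12 n13.
have [[[p1 _] [p2 _]] [p3 _]] := (m1, m2, m3).
have [_ P1] := maximal_prime m1; have [_ P2] := maximal_prime m2.
have [_ P3] := maximal_prime m3.
have [r1 r2 r3] := And3 (pideal_rng p1) (pideal_rng p2) (pideal_rng p3).
have unit N z : proper_ideal B N -> N (1 - z) -> ~ N z.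
  move=> pN Nz1 Nz; apply: (pideal1 pN).
  by rewrite -(subrK z 1); apply: (rngD (pideal_rng pN)).
have nx0 : x != 0.
  by apply: contra_notN (unit _ _ p1 x1) => /eqP->; apply: rng0.
have [u [v [[E Bux Buy Bvx Bvy] [Hu Hv]]]] := @two_generated_stable x y (or_introl nx0).
(* Multiplication by z maps x and y into D x + D y. Modulo each maximal ideal the residues of x and
   y are 0 or 1, which isolates the coefficients; one that lies in a single maximal ideal of B is in
   M, hence lies in all three. *)
pose z := u * x.
have z3 : N3 z.
  have : N3 (z * y).
    by rewrite (_ : z * y = x * (u * y)) /z; [apply: (pidealMr p3)|ring].
  by move=> /(P3 _ _ Bux By)[//|/(unit _ _ p3 y3)].
have z1 : N1 (1 - z).
  have -> : 1 - z = v * y by rewrite -E /z; ring.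
  have : N1 (v * y * x).
    by rewrite (_ : v * y * x = y * (v * x)); [apply: (pidealMr p1)|ring].
  by move=> /(P1 _ _ Bvy Bx)[//|/(unit _ _ p1 x1)].
have xI : span D [:: x; y] x by apply: mem_span; rewrite // inE eqxx.
have yI : span D [:: x; y] y by apply: mem_span; rewrite // !inE eqxx orbT.
have /span2P[a [b [Da Db Ezx]]] := Hu x x xI xI.
have /span2P[c [d [Dc Dd Ezy]]] := Hu x y xI yI.
rewrite -/z in Ezx Ezy.
have Mb : M b.
  apply: (maximal_contract m3) => //.
  have : N3 (b * y).
    have -> : b * y = z * x - a * x by rewrite Ezx; ring.
    by apply: rngB => //; apply: (pidealM p3) => //; apply: DB.
  by move=> /(P3 _ _ (DB Db) By)[//|/(unit _ _ p3 y3)].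
have Mc : M c.
  apply: (maximal_contract m1) => //.
  have : N1 (c * x).
    have -> : c * x = z * y - d * y by rewrite Ezy; ring.
    by apply: rngB => //; apply: (pidealM p1) => //; apply: DB.
  by move=> /(P1 _ _ (DB Dc) Bx)[//|/(unit _ _ p1 x1)].
have Md : M d.
  apply: (maximal_contract m3) => //.
  have : N3 (d * y).
    have -> : d * y = y * z - x * c by rewrite [y * z]mulrC Ezy; ring.
    by apply: rngB => //; [apply: (pidealM p3)|apply: (pidealMr p3); rewrite //; apply: DB].
  by move=> /(P3 _ _ (DB Dd) By)[//|/(unit _ _ p3 y3)].
have z2 : N2 z.
  have : N2 (z * y).
    by rewrite Ezy; apply: rngD => //; apply: (pidealMr p2) => //;
      apply: (maximal_over m2).
  by move=> /(P2 _ _ Bux By)[//|/(unit _ _ p2 y2)].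
have Ma : M a.
  apply: (maximal_contract m2) => //.
  have : N2 (a * x).
    have -> : a * x = x * z - y * b by rewrite [x * z]mulrC Ezx; ring.
    by apply: rngB => //; apply: (pidealM p2) => //; apply: (maximal_over m2).
  by move=> /(P2 _ _ (DB Da) Bx)[//|/(unit _ _ p2 x2)].
have : N1 (z * x).
  by rewrite Ezx; apply: rngD => //; apply: (pidealMr p1) => //;
    apply: (maximal_over m1).
by move=> /(P1 _ _ Bux Bx)[/(unit _ _ p1 z1)|/(unit _ _ p1 x1)].
Qed.


Lemma unit_outside_maximal x : B x ->
  (forall N, maximal_ideal B N -> ~ N x) -> B x^-1.
Proof.
move=> Bx H; pose L := [set y | exists2 b, B b & y = x * b].
have [[b Bb E]|L1] := pselect (L 1).
  have x0 : x != 0 by apply: contra_eqN E => /eqP->; rewrite mul0r oner_neq0.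
  by rewrite -[x^-1]mulr1 E mulKf.
have pL : proper_ideal B L.
  split=> //; first by move=> _ [b Bb ->]; apply: rngM.
    split; first by exists 0; rewrite ?mulr0 //; apply: rng0.
      by move=> _ _ [b Bb ->] [c Bc ->]; exists (b - c); rewrite ?mulrBr //; apply: rngB.
    move=> _ _ [b Bb ->] [c Bc ->]; exists (b * (x * c)); rewrite ?mulrA //.
    by apply: rngM => //; apply: rngM.
  by move=> y _ By [b Bb ->]; exists (y * b); [apply: rngM|ring].
have [N mN /(_ x) Nx] := exists_maximal sB pL.
by case: (H N mN); apply: Nx; exists 1; rewrite ?mulr1.
Qed.

Lemma integral_inter x : (forall N, maximal_ideal B N -> loc N x) -> B x.
Proof.
move=> H; pose L := [set w | B w /\ B (w * x)].
have [[_]|L1] := pselect (L 1); first by rewrite mul1r.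
have pL : proper_ideal B L.
  split=> //; first by move=> ? [].
    split; first by split; rewrite ?mul0r; apply: rng0.
      by move=> y z [? ?] [? ?]; split; rewrite ?mulrBl; apply: rngB.
    by move=> y z [? ?] [? ?]; split; rewrite -?mulrA; apply: rngM.
  by move=> y z By [? ?]; split; rewrite -?mulrA; apply: rngM.
have [N mN LN] := exists_maximal sB pL.
have [y [w [By Bw nw E]]] := H N mN; case: (nw); apply: LN; split=> //.
by rewrite E mulrC divfK //; apply: prime_neq0 nw; apply: maximal_prime mN.
Qed.

(** If y = c/m^k is in B with y^2 = r + t y, then c^2/m^k = r m^k + t c is in D; the archimedean
    property of D is therefore applied to c^2. *)
Lemma integral_power_bound m c : mori D -> M m -> m != 0 -> D c -> c != 0 ->
  exists k, ~ B (c / m ^+ k).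
Proof.
move=> mD Mm m0 Dc c0; have Dm := MD Mm.
have mV : ~ D m^-1 by move=> DV; apply: (local_unit lD Dm DV m0 Mm).
have [k nD] := mori_archimedean sD mD Dm m0 mV (subringX 2 sD Dc)
  (expf_neq0 2 c0).
exists k => Bk; apply: nD; have [r [t [Dr Dt E]]] := quadratic Bk.
have -> : c ^+ 2 / m ^+ k = r * m ^+ k + t * c.
  have mk0 : m ^+ k != 0 by rewrite expf_neq0.
  have -> : r = (c / m ^+ k) ^+ 2 - t * (c / m ^+ k) by rewrite E addrK.
  by field.
by apply: rngD => //; apply: rngM => //; apply: subringX.
Qed.

(** A comaximal element a/c has the uncontrolled denominator c; the point is to reach a power of m.
    Choose k with c/m^k not in B and write 1 = u c + v m^k by stability. Then m^k (u c) is in D, and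
    either u c or 1 - u c separates N1 from N2, or u c is a unit of B and a/c itself can be kept. *)
Lemma split_element m N1 N2 : mori D -> M m -> m != 0 ->
    maximal_ideal B N1 -> maximal_ideal B N2 -> N1 <> N2 ->
  exists e k, [/\ B e, D (m ^+ k * e), N1 e & N2 (1 - e)].
Proof.
move=> mD Mm m0 m1 m2 n12; have Dm k : D (m ^+ k) := subringX k sD (MD Mm).
have [e0 [Be0 N1e0 N2e0]] := maximal_comax m1 m2 n12.
have [a [c [Da Dc c0 Ee0]]] := fracD e0.
have [k nB] := integral_power_bound mD Mm m0 Dc c0.
have mk0 : m ^+ k != 0 by rewrite expf_neq0.
have [u [v [[E Buc Bum Bvc Bvm] [Hu Hv]]]] :=
  @two_generated_stable c (m ^+ k) (or_introl c0).
have spanD : span D [:: c; m ^+ k] `<=` D.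
  apply: span_min => [|x]; first exact: submod_self.
  by rewrite !inE => /orP[] /eqP->.
have cI : span D [:: c; m ^+ k] c by apply: mem_span; rewrite // inE eqxx.
have mI : span D [:: c; m ^+ k] (m ^+ k).
  by apply: mem_span; rewrite // !inE eqxx orbT.
have unit x : B x -> ~ N1 x -> ~ N2 x -> B x^-1.
  move=> Bx x1 x2; apply: unit_outside_maximal => // N mN Nx.
  apply: (@maximal_at_most_two N1 N2 N) => // [E1|E2].
    by apply: x1; rewrite E1.
  by apply: x2; rewrite E2.
have Dme : D (m ^+ k * (u * c)).
  by rewrite mulrC; apply: spanD; apply: Hu.
have [] := pselect (~ N1 (u * c) /\ ~ N2 (u * c)).
  move=> [n1 n2]; have [r [t [Dr Dt Er]]] := quadratic (unit _ Buc n1 n2).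
  (* For w = 1/(u c), w^2 = r + t w gives m^k w = r (m^k u c) + t m^k in D. The exponent 3k comes
     from m^(3k) a/c = a (u m^(2k)) (m^k w). *)
  exists e0, (3 * k)%N; split=> //.
  have := prime_neq0 (maximal_prime m1) n1.
  rewrite mulf_eq0 negb_or => /andP[u0 _].
  have -> : m ^+ (3 * k) * e0 =
      a * (u * m ^+ k * m ^+ k) * (r * (m ^+ k * (u * c)) + t * m ^+ k).
    have -> : r = (u * c)^-1 ^+ 2 - t * (u * c)^-1 by rewrite Er addrK.
    by rewrite mulnC exprM Ee0; field; rewrite u0 c0.
  apply: rngM => //; first by apply: rngM => //; apply: spanD; apply: Hu.
  by apply: rngD => //; apply: rngM.
move=> /not_andP; rewrite !notK => He.
(* Otherwise 1 - u c = v m^k is a unit of B, and c/m^k = v c / (v m^k) is in B, against the choice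
   of k. *)
have : N1 (1 - u * c) \/ N2 (1 - u * c).
  apply: contrapT => /not_orP[n1 n2]; apply: nB.
  have Ev : 1 - u * c = v * m ^+ k by rewrite -E; ring.
  have := unit _ (rngB rB B1 Buc) n1 n2; rewrite Ev => H.
  have v0 : v != 0.
    have := prime_neq0 (maximal_prime m1) n1.
    by rewrite Ev mulf_eq0 negb_or => /andP[].
  have -> : c / m ^+ k = v * c * (v * m ^+ k)^-1 by field; rewrite v0 mk0.
  exact: rngM.
have no N : maximal_ideal B N -> N (u * c) -> ~ N (1 - u * c).
  move=> [pN _] Ne N1e; apply: (pideal1 pN).
  by rewrite -(subrK (u * c) 1); apply: (rngD (pideal_rng pN)).
case: He => He [] He1; try by [case: (no _ m1 He)|case: (no _ m2 He)].
  by exists (u * c), k.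
exists (1 - u * c), k; split=> //; first exact: rngB.
  by rewrite mulrBr mulr1; apply: rngB.
by rewrite opprB addrCA subrr addr0.
Qed.

(** * Divisorial maximal ideal: the integral closure as an intersection of two DVRs *)

Section WithGenerator.
Hypothesis mD : mori D.
Hypothesis zD : exists2 z, ~ D z & forall x, M x -> D (z * x).

Lemma local_maximal_neq0 : exists2 m, M m & m != 0.
Proof.
apply: contrapT => H; case: zD => z nD _; apply: nD.
have [a [b [Da Db b0 ->]]] := fracD z; apply: rngM => //; apply: uD => // Mb.
by apply: H; exists b.
Qed.

Lemma local_maximal_divisorial : v_op D M = M.
Proof.
apply/seteqP; split=> [x vx|]; last exact: v_op_sub.
have [z nD zM] := zD; apply: contrapT => nM; apply: nD.
have Dx : D x by apply: v_op_min vx => //; apply: v_op_ring.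
rewrite -[z]mul1r -(mulVf (local_neq0 lD nM)) -mulrA.
by apply: rngM; [|apply: uD|apply: vx => y /zM].
Qed.

(* (M : M) is integral over D: if b is not integral, the endomorphism ring of
   D + D b is D itself, so D + D b is principal. *)
Lemma overmaximal_integral b : (forall x, M x -> M (b * x)) -> B b.
Proof.
move=> bM; apply: contrapT => nB.
have ms := span_submod [:: 1; b] sD.
have s1 : span D [:: 1; b] 1 by apply: mem_span; rewrite // inE eqxx.
have sb : span D [:: 1; b] b by apply: mem_span; rewrite // !inE eqxx orbT.
have nz : (1 : K) != 0 \/ b != 0 by left; apply: oner_neq0.
have [u [v [[E _ _ _ _] [Hu Hv]]]] := two_generated_stable nz.
have endo w : (forall y, span D [:: 1; b] y -> span D [:: 1; b] (w * y)) -> D w.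
  move=> Hw; have Bw : B w.
    exists [:: 1; b]; split; first by exists 1; rewrite ?oner_neq0 // inE eqxx.
    by move=> y ys; apply: Hw; apply: mem_span.
  have := Hw 1 s1; rewrite mulr1 => /span2P[p [q [Dp Dq Ew]]].
  have [Mq|nMq] := pselect (M q).
    rewrite Ew mulr1; apply: rngD => //; rewrite mulrC.
    exact/MD/bM.
  case: nB; have -> : b = q^-1 * (w - p).
    by rewrite Ew mulr1 addrC addKr mulKf //; exact: local_neq0 lD nMq.
  apply: rngM => //; first exact/DB/uD.
  by apply: rngB => //; apply: DB.
have Du : D u by rewrite -[u]mulr1; apply: endo => y; apply: Hu.
have Dub : D (u * b) by apply: endo => y; apply: Hu.
have Dv : D v by rewrite -[v]mulr1; apply: endo => y; apply: Hv.
have Dvb : D (v * b) by apply: endo => y; apply: Hv.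
(* Since u + v b = 1 with u, u b, v, v b in D, either u or v b is a unit of D; accordingly b or b^-1
   is in D. If b^-1 were in M, then 1 = b b^-1 would be too. *)
rewrite mulr1 in E; have [Mu|nMu] := pselect (M u); last first.
  apply: nB; have -> : b = u^-1 * (u * b).
    by rewrite mulKf //; exact: local_neq0 lD nMu.
  by apply: rngM => //; apply: DB => //; apply: uD.
have nMvb : ~ M (v * b).
  by move=> Mvb; apply: (pideal1 pM); rewrite -E; apply: rngD.
have := local_neq0 lD nMvb; rewrite mulf_eq0 negb_or => /andP[v0 b0].
have Db : D b^-1.
  have -> : b^-1 = v * (v * b)^-1 by field; rewrite v0 b0.
  by apply: rngM => //; apply: uD.
have [Mb|nMb] := pselect (M b^-1).
  by apply: (pideal1 pM); rewrite -(mulfV b0); apply: bM.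
by apply: nB; rewrite -[b]invrK; apply/DB/uD.
Qed.

(** M is the v-closure of a finitely generated ideal D s, and 1 is the sum of the u_i s_i by
    stability. Some u_i s_i is outside N, and x/s_i = u_i x / (u_i s_i), where u_i x is integral for
    every x in M. *)
Lemma maximal_generated N : maximal_ideal B N ->
  exists f, generates (loc N) f M.
Proof.
move=> mN; have [pN mxN] := mN.
have [s [nz sM Ms]] : exists s, [/\ exists2 x, x \in s & x != 0,
    forall x, x \in s -> M x & M `<=` v_op D (span D s)].
  apply: mori_fin_gen => //; apply: integral_idealP => //.
    exact: pideal_submod.
  exact: local_maximal_neq0.
have [u [Hu E]] := fsD nz.
have vM : v_op D (span D s) `<=` M.
  apply: v_op_min; last exact: local_maximal_divisorial.
  by apply: span_min => //; apply: pideal_submod.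
(* The inclusion u_i (D s)(D s) in D s extends, one factor at a time, to u_i M M in M, because M is
   divisorial; so u_i x multiplies M into itself. *)
have Bux i x : M x -> B (u i * x).
  move=> Mx; apply: overmaximal_integral => y My; apply: vM => w Hw.
  have H1 a : span D s a -> D (y * (w * (u i * a))).
    move=> sa; apply: (Ms y My) => b sb.
    by rewrite -mulrA; apply: Hw; apply: Hu.
  have := Ms x Mx (w * (u i * y)).
  rewrite (_ : u i * x * y * w = x * (w * (u i * y))); last by ring.
  apply=> a sa; have := H1 a sa.
  by rewrite (_ : y * _ = w * (u i * y) * a) //; ring.
have [i lt nN] : exists2 i, (i < size s)%N & ~ N (u i * s`_i).
  apply: contrapT => H; apply: (pideal1 pN); rewrite E.
  apply: rng_sum; first exact: pideal_rng pN.
  by move=> i _; apply: contrapT => nN; apply: H; exists i.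
have := prime_neq0 (maximal_prime mN) nN.
rewrite mulf_eq0 negb_or => /andP[u0 s0].
have Msi : M s`_i by apply: sM; apply: mem_nth.
exists s`_i; split=> //.
move=> x Mx; exists (u i * x), (u i * s`_i); split=> //; first exact: Bux.
  exact: Bux.
by field; rewrite u0 s0.
Qed.

Lemma exists_max_generator : exists m,
  forall N, maximal_ideal B N -> generates (loc N) m M.
Proof.
have [N1 m1 _] := exists_maximal sB (proper_ideal0 sB).
have [f Hf] := maximal_generated m1.
have [[N2 [m2 n21]]|H] := pselect (exists N2, maximal_ideal B N2 /\ N2 <> N1);
    last first.
  exists f => N mN; suff -> : N = N1 by [].
  by apply: contrapT => n; apply: H; exists N.
have [g Hg] := maximal_generated m2.
have lN N : maximal_ideal B N -> local_ring (loc N) (localize B N N).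
  by move=> /localize_valuation[].
have [h H1 H2] := common_generator (lN _ m1) (lN _ m2) (fun x y => rngD rM) Hf Hg.
exists h => N mN; have [->//|n1] := pselect (N = N1).
have [->//|n2] := pselect (N = N2); exfalso.
by apply: (maximal_at_most_two m1 m2 mN) => E; [apply: n21|apply: n1|apply: n2].
Qed.

Section Generator.
Variable m : K.
Hypothesis gen : forall N, maximal_ideal B N -> generates (loc N) m M.

Let sub_loc N : maximal_ideal B N -> B `<=` loc N.
Proof. by move=> /maximal_prime pN; apply: sub_localize. Qed.

Let inv_loc N w : maximal_ideal B N -> B w -> ~ N w -> loc N w^-1.
Proof. by move=> mN Bw Nw; exists 1, w; rewrite mul1r. Qed.

(** Let y in N with y^2 = r + t y; then r = y (y - t) is in M, so m divides it. If t is in M, m also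
    divides t. If not, y - t is a unit at N and y = r/(y - t). *)
Lemma generator_square N n : maximal_ideal B N -> localize B N N n ->
  loc N (n ^+ 2 / m).
Proof.
move=> mN [y [w [Ny Bw Nw ->]]]; have [m0 Mm Vm] := gen mN.
have prN := maximal_prime mN; have [pN _] := mN.
have [rV _] := localize_subring sB prN.
have w0 := prime_neq0 prN Nw.
have -> : (y / w) ^+ 2 / m = y ^+ 2 / m * (w^-1 * w^-1).
  by field; rewrite w0 m0.
have Vw := inv_loc mN Bw Nw.
apply: rngM => //; last exact: rngM.
have By := pideal_sub pN Ny.
have [r [t [Dr Dt E]]] := quadratic By.
have Er : r = y * (y - t) by rewrite mulrBr -expr2 E; ring.
have Mr : M r.
  apply: (maximal_contract mN) => //; rewrite Er; apply: (pidealMr pN) => //.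
  by apply: rngB => //; apply: DB.
have [Mt|nMt] := pselect (M t).
  have -> : y ^+ 2 / m = r / m + t / m * y by rewrite E; field.
  by apply: rngD => //; [apply: Vm|apply: rngM => //; [apply: Vm|apply: sub_loc]].
have nNt : ~ N t by move=> /(maximal_contract mN Dt).
have nNyt : ~ N (y - t).
  move=> H; apply: nNt; rewrite -(subKr y t).
  by apply: (rngB (pideal_rng pN)).
have yt0 := prime_neq0 prN nNyt.
have -> : y ^+ 2 / m = r / m * (y * (y - t)^-1) by rewrite Er; field; rewrite m0 yt0.
apply: rngM => //; first exact: Vm.
apply: rngM => //; first exact: sub_loc.
by apply: inv_loc => //; apply: rngB => //; apply: DB.
Qed.

(* Otherwise the fractional ideals e^-j (D + De)^v would form an infinite
   ascending chain. *)
Lemma split_archimedean N e k a : maximal_ideal B N -> B e -> e != 0 -> N e ->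
  D (m ^+ k * e) -> a != 0 -> exists j, ~ B (a / e ^+ j).
Proof.
move=> mN Be e0 Ne Dme a0; apply: contrapT => H.
have {}H j : B (a / e ^+ j) by apply: contrapT => n; apply: H; exists j.
have [p [q [Dp Dq q0 Ea]]] := fracD a.
have p0 : p != 0 by apply: contraNN a0 => /eqP p0; rewrite Ea p0 mul0r.
have Hp j : B (p / e ^+ j).
  have -> : p / e ^+ j = q * (a / e ^+ j).
    by rewrite Ea; field; rewrite q0 expf_neq0.
  by apply: rngM => //; apply: DB.
have [m0 Mm Vm] := gen mN.
have [prN [pN _]] := (maximal_prime mN, mN).
have ej0 j : e ^+ j != 0 by rewrite expf_neq0.
have mk0 : m ^+ k != 0 by rewrite expf_neq0.
pose S := span D [:: 1; e]; have mS : submodule D S := span_submod _ sD.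
have [S0 SD SZ] := mS.
have S1 : S 1 by apply: mem_span; rewrite // inE eqxx.
have Se : S e by apply: mem_span; rewrite // !inE eqxx orbT.
have [r [t [Dr Dt E]]] := quadratic Be.
have SE y : S y -> S (e * y).
  move=> Sy; apply: (span_min (I := [set y | S (e * y)])) Sy => /=.
    split=> /=; first by rewrite mulr0.
      by move=> *; rewrite mulrDr; apply: SD.
    by move=> *; rewrite mulrCA; apply: SZ.
  move=> z; rewrite !inE => /orP[] /eqP->; first by rewrite mulr1.
  by rewrite -expr2 E -[r]mulr1; apply: SD; apply: SZ.
have SX j y : S y -> S (e ^+ j * y).
  by elim: j => [|j IH] Sy; rewrite ?mul1r // exprS -mulrA; apply/SE/IH.
have SM x y : S x -> S y -> S (x * y).
  move=> Sx Sy; apply: (span_min (I := [set x | S (x * y)])) Sx => /=.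
    split=> /=; first by rewrite mul0r.
      by move=> *; rewrite mulrDl; apply: SD.
    by move=> *; rewrite -mulrA; apply: SZ.
  by move=> z; rewrite !inE => /orP[] /eqP->; rewrite ?mul1r //; apply: SE.
have Sp j : S (p ^+ 2 / e ^+ j).
  have [r' [t' [Dr' Dt' E']]] := quadratic (Hp j).
  have -> : p ^+ 2 / e ^+ j = r' * (e ^+ j * 1) + t' * p * 1.
    have -> : r' = (p / e ^+ j) ^+ 2 - t' * (p / e ^+ j) by rewrite E' addrK.
    by field.
  by apply: SD; apply: SZ => //; [apply: SX|apply: rngM].
have Dmk : D (m ^+ k) := subringX k sD (MD Mm).
have mkS : colon D S (m ^+ k).
  move=> y /(span_min (I := [set y | D (m ^+ k * y)])); apply=> /=.
    split=> /=; first by rewrite mulr0; apply: rng0.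
      by move=> *; rewrite mulrDr; apply: rngD.
    by move=> *; rewrite mulrCA; apply: rngM.
  by move=> z; rewrite !inE => /orP[] /eqP->; rewrite ?mulr1.
have mp0 : m ^+ k * p ^+ 2 != 0 by rewrite mulf_neq0 // expf_neq0.
(* This is m^k p^2 e^-j S^v. It is integral because p^2/e^j lies in the ring S, by the relation for
   p/e^j, and m^k S lies in D; it ascends because e S lies in S. *)
pose I j := colon D
  [set x | exists2 w, colon D S w & x = w * e ^+ j / (m ^+ k * p ^+ 2)].
have [||n Hn] := mD (I := I).
- move=> j; apply: divisorial_colon => //.
    move=> x Hx; rewrite -[x]mulr1; apply: Hx.
    exists (m ^+ k * (p ^+ 2 / e ^+ j)).
      by move=> y Sy; rewrite -mulrA; apply: mkS; apply: SM.
    by field; rewrite mk0 p0 ej0.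
  exists (m ^+ k * p ^+ 2) => // _ [w Hw ->].
  by rewrite mulrC divfK //; apply: Hw; rewrite -[e ^+ j]mulr1; apply: SX.
- move=> j x Hx _ [w Hw ->]; apply: Hx; exists (w * e).
    by move=> y Sy; rewrite -mulrA; apply/Hw/SE.
  by rewrite exprS mulrA.
(* The chain is constant from n on, so [I n] contains m^k p^2 e^-(n+j); the element m^k of (D : S)
   turns this into m^k/e^j in D. *)
have De j : D (m ^+ k / e ^+ j).
  have : I (n + j)%N (m ^+ k * p ^+ 2 / e ^+ (n + j)).
    move=> _ [w Hw ->].
    rewrite (_ : _ * _ = w * 1); first exact: Hw.
    by field; rewrite mk0 p0 ej0.
  rewrite Hn ?leq_addr // => Hx.
  have -> : m ^+ k / e ^+ j = m ^+ k * p ^+ 2 / e ^+ (n + j) *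
      (m ^+ k * e ^+ n / (m ^+ k * p ^+ 2)).
    by rewrite exprD; field; rewrite mk0 p0 !ej0.
  by apply: Hx; exists (m ^+ k).
have [rV V1] := localize_subring sB prN.
have Ve : loc N (e ^+ 2 / m).
  by apply: generator_square => //; apply: sub_localize.
(* The exponent is chosen so that m^k / e^(2(k+1)) times (e^2/m)^(k+1) is exactly m^-1. *)
have := rngM rV (sub_loc mN (DB (De (2 * k.+1)%N))) (subringX k.+1 (conj rV V1) Ve).
rewrite (_ : _ * _ = m^-1) => [Vm1|].
  apply: (local_unit (localize_local sB prN) _ Vm1 m0).
    exact/sub_loc/DB/MD.
  by apply: sub_localize => //; apply: maximal_over.
rewrite expr_div_n -exprM [m ^+ k.+1]exprS; field.
by rewrite m0 mk0 ej0.
Qed.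

(** If N is the only maximal ideal, B is its localization and [integral_power_bound] applies. If
    there is another one N', use f in N that is 1 modulo N' and divides m at N: infinite
    divisibility by m at N becomes infinite divisibility by f in B. *)
Lemma localize_archimedean N a : maximal_ideal B N -> a != 0 ->
  exists k, ~ loc N (a / m ^+ k).
Proof.
move=> mN a0; apply: contrapT => H.
have {}H k : loc N (a / m ^+ k) by apply: contrapT => n; apply: H; exists k.
have [m0 Mm Vm] := gen mN.
have [prN [pN _]] := (maximal_prime mN, mN).
have [rV V1] := localize_subring sB prN.
have mk0 k : m ^+ k != 0 by rewrite expf_neq0.
have [p [q [Dp Dq q0 Ea]]] := fracD a.
have p0 : p != 0 by apply: contraNN a0 => /eqP p0; rewrite Ea p0 mul0r.
have Hp j : loc N (p / m ^+ j).
  have -> : p / m ^+ j = q * (a / m ^+ j) by rewrite Ea; field; rewrite q0 mk0.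
  by apply: rngM => //; apply/sub_loc/DB.
have [[N' [mN' nN']]|U] := pselect (exists N', maximal_ideal B N' /\ N' <> N);
    last first.
  have [k] := integral_power_bound mD Mm m0 Dp p0; apply.
  apply: integral_inter => N' mN'; suff -> : N' = N by [].
  by apply: contrapT => n; apply: U; exists N'.
have [e [k [Be De Ne Ne']]] := split_element mD Mm m0 mN mN' (nesym nN').
have [rN rN'] := (pideal_rng pN, pideal_rng (mN'.1)).
(* The element f is e, m or e + m. When e does not divide m at N, e/m is a nonunit there and e + m
   is m times a unit; adding m changes nothing modulo N', which contains M. *)
have [f [Bf Df Nf Nf' [f0 Vf]]] : exists f, [/\ B f, D (m ^+ k * f), N f,
    N' (1 - f) & f != 0 /\ loc N (m / f)].
  have Nm : N m by apply: maximal_over.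
  have Bm : B m by apply/DB/MD.
  have [e0|e0] := eqVneq e 0.
    exists m; split=> //.
    - by rewrite -exprSr; apply: subringX => //; apply: MD.
    - rewrite (_ : 1 - m = (1 - e) - m); last by rewrite e0 subr0.
      by apply: rngB => //; apply: maximal_over.
    - by split=> //; rewrite divff.
  have [Vme|nVme] := pselect (loc N (m / e)); first by exists e.
  have Pem : localize B N N (e / m).
    have [[_ pP u] tot] := localize_valuation mN.
    apply: contrapT => nP; have [//|] := tot (m / e) (mulf_neq0 m0 (invr_neq0 e0)).
    by rewrite invf_div => /u/(_ nP); rewrite invf_div.
  have [_ pP uV] := localize_local sB prN.
  have nP : ~ localize B N N (1 - - (e / m)).
    apply: (local_sub1 (localize_local sB prN)).
    by apply: rngN => //; apply: pideal_rng pP.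
  have E : m / (e + m) = (1 - - (e / m))^-1.
    have -> : e + m = m * (1 - - (e / m)) by field.
    by rewrite invfM mulrA divff // mul1r.
  have n0 := local_neq0 (localize_local sB prN) nP.
  exists (e + m); split.
  - exact: rngD.
  - rewrite mulrDr -exprSr; apply: rngD => //; apply: subringX => //; exact: MD.
  - exact: rngD.
  - by rewrite opprD addrA; apply: rngB => //; apply: maximal_over.
  - split; last rewrite E.
      have -> : e + m = m * (1 - - (e / m)) by field.
      by rewrite mulf_neq0.
    apply: uV => //; apply: rngB => //; apply: rngN => //.
    exact: (pideal_sub pP).
have [j] := split_archimedean mN Bf f0 Nf Df p0; apply.
apply: integral_inter => N'' mN''.
have fj0 : f ^+ j != 0 by rewrite expf_neq0.
have [->|n1] := pselect (N'' = N).
  have -> : p / f ^+ j = p / m ^+ j * (m / f) ^+ j.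
    by rewrite expr_div_n; field; rewrite mk0 fj0.
  by apply: rngM => //; apply: subringX.
have [->|n2] := pselect (N'' = N'); last first.
  by case: (maximal_at_most_two mN mN' mN'') => E; [apply: nN'|apply: n1|apply: n2].
exists p, (f ^+ j); split; [exact: DB|exact: subringX| |by []].
move=> /(primeX sB (maximal_prime mN') Bf) H'.
apply: (pideal1 mN'.1); rewrite -(subrK f 1).
exact: rngD.
Qed.

End Generator.

(** The two rings coincide when B has a single maximal ideal. The last clause is what later yields
    dimension one. *)
Lemma integral_closure_two_dvr : exists V1 P1 V2 P2,
  [/\ valuation V1 P1 /\ dvr V1, valuation V2 P2 /\ dvr V2, B = V1 `&` V2,
    forall x, M x -> P1 x /\ P2 x &
    forall x a, M x -> x != 0 -> a != 0 ->
      exists k, V1 (x ^+ k / a) /\ V2 (x ^+ k / a)].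
Proof.
have [m gen] := exists_max_generator.
have [N1 m1 _] := exists_maximal sB (proper_ideal0 sB).
have [N2 m2 all] : exists2 N2, maximal_ideal B N2 &
    forall N, maximal_ideal B N -> N = N1 \/ N = N2.
  have [[N2 [m2 n21]]|H] := pselect (exists N2, maximal_ideal B N2 /\ N2 <> N1).
    exists N2 => // N mN; have [|n1] := pselect (N = N1); first by left.
    right; apply: contrapT => n2.
    by apply: (maximal_at_most_two m1 m2 mN) => E; [apply: n21|apply: n1|apply: n2].
  exists N1 => // N mN; left; apply: contrapT => n1.
  by apply: H; exists N.
have over N x : maximal_ideal B N -> M x -> localize B N N x.
  move=> mN Mx; apply: sub_localize => //; first exact: maximal_prime.
  exact: maximal_over.
have isdvr N : maximal_ideal B N ->
    valuation (loc N) (localize B N N) /\ dvr (loc N).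
  move=> mN; have vN := localize_valuation mN; split=> //.
  have [m0 Mm _] := gen N mN.
  have sq n : localize B N N n -> loc N (n ^+ 2 / m).
    by move=> Pn; apply: generator_square.
  have [p Hp] := valuation_uniformizer vN (over N m mN Mm) m0 sq.
  apply: (uniformizer_dvr vN Hp) => a a0.
  have [k nV] := localize_archimedean gen mN a0.
  (* As p^2/m is in the valuation ring, divisibility by p^(2k) implies divisibility by m^k. *)
  have [p0 Pp _] := Hp; exists (2 * k)%N => Va; apply: nV.
  have [rV V1] := localize_subring sB (maximal_prime mN).
  have := rngM rV Va (subringX k (conj rV V1) (sq _ Pp)).
  by rewrite exprM expr_div_n mulrA divfK // !expf_neq0.
have arch N x a : maximal_ideal B N -> M x -> x != 0 -> a != 0 ->
    exists k, loc N (x ^+ k / a).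
  move=> mN Mx x0 a0; have [k nV] := localize_archimedean gen mN a0.
  have [m0 Mm Vm] := gen N mN; exists k.
  have [_ tot] := localize_valuation mN.
  have [rV V1] := localize_subring sB (maximal_prime mN).
  have [//|] := tot (x ^+ k / a) (mulf_neq0 (expf_neq0 k x0) (invr_neq0 a0)).
  rewrite invf_div => Va; case: nV.
  have := rngM rV Va (subringX k (conj rV V1) (Vm x Mx)).
  by rewrite expr_div_n mulrA divfK // expf_neq0.
exists (loc N1), (localize B N1 N1), (loc N2), (localize B N2 N2); split.
- exact: isdvr.
- exact: isdvr.
- apply/seteqP; split=> [x Bx|x [V1x V2x]].
    by split; apply: sub_localize => //; apply: maximal_prime.
  by apply: integral_inter => N /all[->|->].
- by move=> x Mx; split; apply: over.
- move=> x a Mx x0 a0; have [k1 H1] := arch N1 x a m1 Mx x0 a0.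
  have [k2 H2] := arch N2 x a m2 Mx x0 a0.
  have Vx N : maximal_ideal B N -> loc N x.
    move=> mN; apply: sub_localize; [exact: sB|exact: maximal_prime|exact/DB/MD].
  exists (k1 + k2)%N; rewrite exprD -mulrA; split; last first.
    have sV := localize_subring sB (maximal_prime m2).
    by apply: rngM => //; [case: sV|apply: subringX => //; apply: Vx].
  have sV := localize_subring sB (maximal_prime m1).
  rewrite mulrCA; apply: rngM => //; [by case: sV|].
  by apply: subringX => //; apply: Vx.
Qed.

End WithGenerator.
End LocalMori.

(** * Globalization *)

Section LocalConsequences.
Variable K : fieldType.
Implicit Types (A D I J M V : set K).

Definition full_ring D : Prop :=
  subring D /\ forall z, exists x y, [/\ D x, D y, y != 0 & z = x / y].

(* Under the conditions of the theorem, the localizations of a Mori domain at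
   its t-maximal ideals are of this kind. *)
Definition mori_stable_local D M : Prop :=
  [/\ local_ring D M, finitely_stable D, full_ring D, mori D &
      exists2 z, ~ D z & forall x, M x -> D (z * x)].

Lemma dvr_generates V I : dvr V -> (exists2 x, I x & x != 0) ->
    (exists2 d, d != 0 & forall x, I x -> V (d * x)) ->
  exists f, generates V f I.
Proof.
move=> [v [vM vD vs] ->] [x0 Ix0 x00] [d d0 Hd].
have v1 : v 1 = 0.
  have := vM 1 1 (oner_neq0 K) (oner_neq0 K); rewrite mulr1 => /eqP.
  by rewrite -subr_eq0 opprD addrA subrr add0r oppr_eq0 => /eqP.
have vV x : x != 0 -> v x^-1 = - v x.
  move=> n0; apply/eqP; rewrite -addr_eq0 -vM ?invr_neq0 //.
  by rewrite mulVf // v1.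
have [|n [f [If f0 En]] min] := @ex_min_prop (fun n : nat =>
    exists f, [/\ I f, f != 0 & v (d * f) = n%:Z]).
  have : 0 <= v (d * x0).
    by case: (Hd _ Ix0) => // /eqP; rewrite mulf_eq0 (negPf d0) (negPf x00).
  by case E: (v (d * x0)) => [n|//] _; exists n, x0.
exists f; split=> // x Ix /=; have [->|n0] := eqVneq x 0.
  by left; rewrite mul0r.
right; rewrite vM ?invr_neq0 // vV // subr_ge0.
have : v (d * f) <= v (d * x).
  have : 0 <= v (d * x).
    by case: (Hd _ Ix) => // /eqP; rewrite mulf_eq0 (negPf d0) (negPf n0).
  case E: (v (d * x)) => [k|//] _; rewrite En lez_nat leqNgt.
  by apply/negP => /min; apply; exists x.
by rewrite !vM // lerD2l.
Qed.

Variables D M : set K.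
Hypothesis HD : mori_stable_local D M.

Let sD : subring D. Proof. by case: HD => [[]]. Qed.
Let rD : rng D. Proof. by case: sD. Qed.

Lemma local_two_dvr : exists V1 P1 V2 P2,
  [/\ valuation V1 P1 /\ dvr V1, valuation V2 P2 /\ dvr V2,
    integral_elt D = V1 `&` V2, forall x, M x -> P1 x /\ P2 x &
    forall x a, M x -> x != 0 -> a != 0 ->
      exists k, V1 (x ^+ k / a) /\ V2 (x ^+ k / a)].
Proof.
case: HD => lD fs [_ fr] mD zD.
exact: (integral_closure_two_dvr lD fs fr mD zD).
Qed.

Lemma local_quadratic x : integral_elt D x ->
  exists r t, [/\ D r, D t & x ^+ 2 = r + t * x].
Proof. by apply: integral_quadratic => //; case: HD. Qed.

(** For a = p/q, some y = x^k/p is integral, and x^(2k)/p = p y^2 = r p + t x^k is in D; multiplying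
    by q gives x^(2k)/a. *)
Lemma local_power x a : M x -> a != 0 -> exists k, D (x ^+ k / a).
Proof.
move=> Mx a0; have [x00|x0] := eqVneq x 0.
  by exists 1%N; rewrite expr1 x00 mul0r; apply: rng0.
have [V1 [P1 [V2 [P2 [_ _ E _ pow]]]]] := local_two_dvr.
have [[_ _ _] _ [_ fr] _ _] := HD.
have [p [q [Dp Dq q0 Ea]]] := fr a.
have p0 : p != 0 by apply: contraNN a0 => /eqP p0; rewrite Ea p0 mul0r.
have [k Hk] := pow x p Mx x0 p0.
have : integral_elt D (x ^+ k / p) by rewrite E.
move=> /local_quadratic[r [t [Dr Dt Exp]]]; exists (2 * k)%N.
have Dx : D x by case: HD => [[_ pM _] _ _ _ _]; apply: (pideal_sub pM).
have -> : x ^+ (2 * k) / a = q * (r * p + t * x ^+ k).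
  have -> : r = (x ^+ k / p) ^+ 2 - t * (x ^+ k / p) by rewrite Exp addrK.
  by rewrite mulnC exprM Ea; field; rewrite p0 q0.
apply: rngM => //; apply: rngD => //; apply: rngM => //.
exact: subringX.
Qed.

(** Take h in I generating I in both DVRs. Then I/h is a module between D and its integral closure,
    hence a ring, and I = h (I : I). *)
Lemma local_generator I : submodule D I -> (exists2 x, I x & x != 0) ->
    (exists2 d, d != 0 & forall x, I x -> integral_elt D (d * x)) ->
  exists h, [/\ h != 0, I h, forall x, I x -> integral_elt D (x / h) &
    forall x y, I x -> I y -> I (x * y / h)].
Proof.
move=> mI nz [d d0 Hd]; have [V1 [P1 [V2 [P2 [[[l1 _] d1] [[l2 _] d2] E _ _]]]]] :=
  local_two_dvr.
have [f Hf] : exists f, generates V1 f I.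
  by apply: dvr_generates => //; exists d => // x /Hd; rewrite E => -[].
have [g Hg] : exists g, generates V2 g I.
  by apply: dvr_generates => //; exists d => // x /Hd; rewrite E => -[].
have [I0 ID IZ] := mI.
have [h [h0 Ih H1] [_ _ H2]] := common_generator l1 l2 ID Hf Hg.
have Bh x : I x -> integral_elt D (x / h).
  by move=> Ix; rewrite E; split; [apply: H1|apply: H2].
exists h; split=> // x y Ix Iy.
pose H := [set w | I (w * h)].
have mH : submodule D H.
  split; rewrite /H /= ?mul0r //; first by move=> *; rewrite mulrDl; apply: ID.
  by move=> *; rewrite -mulrA; apply: IZ.
have : H (x / h * (y / h)).
  apply: (integral_module_mul sD _ mH); rewrite /H /= ?mul1r ?divfK //.
    by case: HD.
  by move=> w /Bh; rewrite mulfK.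
by rewrite /H /= (_ : x / h * (y / h) * h = x * y / h) //; field.
Qed.

End LocalConsequences.

Lemma monic_integral_elt (K : fieldType) (D : set K) : subring D ->
  integral_closure D `<=` integral_elt D.
Proof.
move=> sD x [p [mp Dp /rootP rx]]; have [rD D1] := sD.
pose n := (size p).-1.
have n0 : (0 < size p)%N by rewrite lt0n size_poly_eq0 monic_neq0.
have Exn : x ^+ n = - \sum_(i < n) p`_i * x ^+ i.
  move: rx; rewrite horner_coef -(prednK n0) big_ord_recr /= -/n.
  have -> : p`_n = 1 by move/monicP: mp.
  by rewrite mul1r addrC => /eqP; rewrite addr_eq0 => /eqP.
case: (posnP n) => [n00|ngt].
  by move: Exn; rewrite n00 big_ord0 oppr0 expr0 => /eqP; rewrite oner_eq0.
pose s := [seq x ^+ i | i <- iota 0 n].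
have ms := span_submod s sD; have [S0 SD SZ] := ms.
have sX i : (i < n)%N -> span D s (x ^+ i).
  by move=> lt; apply: mem_span => //; apply/mapP; exists i; rewrite // mem_iota.
exists s; split.
  exists 1; rewrite ?oner_neq0 //; apply/mapP; exists 0%N => //.
  by rewrite mem_iota.
move=> y /mapP[i]; rewrite mem_iota /= add0n => lt ->; rewrite -exprS.
have [ltn|] := ltnP i.+1 n; first exact: sX.
rewrite leq_eqVlt ltnNge lt orbF => /eqP <-.
rewrite Exn -mulN1r; apply: (SZ); first exact: rngN.
by apply: (submod_sum _ ms) => j _; apply: SZ => //; apply: sX.
Qed.

Lemma sub_integral_closure (K : fieldType) (D : set K) : subring D ->
  D `<=` integral_closure D.
Proof.
move=> [rD D1] x Dx; exists ('X - x%:P); split.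
- exact: monicXsubC.
- move=> i; rewrite coefB coefX coefC.
  by apply: rngB => //; [case: eqP|case: ifP] => // _; apply: rng0.
- by rewrite root_XsubC.
Qed.

(** If x is integral but not in V, then x^-1 is in P, and 1 = x^-1 x contradicts lying over for
    P. *)
Lemma valuation_integrally_closed (K : fieldType) (V P : set K) :
  valuation V P -> integral_elt V `<=` V.
Proof.
move=> [[[rV V1] pP u] tot] x Hx; apply: contrapT => nV.
have x0 : x != 0 by apply: contra_notN nV => /eqP->; apply: rng0.
have [//|Vx] := tot x x0.
have Px : P x^-1.
  by apply: contrapT => /(u _ Vx); rewrite invrK.
apply: (pideal1 pP); apply: (@integral_nakayama _ V P [:: x]) => //.
- exact: pideal_rng pP.
- by move=> d l Vd Pl; apply: (pidealM pP).
- by move=> z; rewrite inE => /eqP->.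
exists (fun i => if i == 0%N then x^-1 else 0); split.
  by case=> [|i] //=; apply: rng0; apply: pideal_rng pP.
by rewrite big_ord1 /= mulVf.
Qed.

Section Products.
Variable K : fieldType.
Implicit Types (A I J L Q : set K).

Lemma mul_min Q I J : Q 0 -> (forall x y, Q x -> Q y -> Q (x + y)) ->
  (forall x y, I x -> J y -> Q (x * y)) -> mul I J `<=` Q.
Proof.
move=> Q0 QD QM _ [s [Hs ->]]; elim: s Hs => [|p s IH] Hs.
  by rewrite big_nil.
rewrite big_cons; apply: QD; first by have [? ?] := Hs p (mem_head _ _); apply: QM.
by apply: IH => q qs; apply: Hs; rewrite inE qs orbT.
Qed.

Lemma mem_mul I J x y : I x -> J y -> mul I J (x * y).
Proof.
by exists [:: (x, y)]; rewrite big_seq1; split=> // p; rewrite inE => /eqP->.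
Qed.

Lemma mul_submod A I J : submodule A I -> submodule A (mul I J).
Proof.
move=> [I0 ID IZ]; split.
- by exists [::]; rewrite big_nil.
- move=> _ _ [s [Hs ->]] [t [Ht ->]]; exists (s ++ t); rewrite big_cat.
  by split=> // p; rewrite mem_cat => /orP[/Hs|/Ht].
- move=> a _ Aa [s [Hs ->]]; exists [seq (a * p.1, p.2) | p <- s]; split.
    by move=> _ /mapP[p /Hs[? ?] ->]; split=> //; apply: IZ.
  by rewrite big_map mulr_sumr; apply: eq_bigr => p _; rewrite mulrA.
Qed.

Lemma colon_submodule A I J : submodule A J -> submodule A (colon J I).
Proof.
move=> [J0 JD JZ]; split.
- by move=> y _; rewrite mul0r.
- by move=> x y Hx Hy z Iz; rewrite mulrDl; apply: JD; [apply: Hx|apply: Hy].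
- by move=> a x Aa Hx z Iz; rewrite -mulrA; apply: JZ => //; apply: Hx.
Qed.

Lemma dvr_almost_integral (V : set K) (c x : K) : dvr V -> c != 0 ->
  (forall k, V (c * x ^+ k)) -> V x.
Proof.
move=> [v [vM _ _] ->] c0 H; have [->|x0] := eqVneq x 0; first by left.
right; rewrite leNgt; apply/negP => vx.
have vx1 : v x <= -1 by rewrite -ltzD1 addNr.
have vk k : v (c * x ^+ k) <= v c - k%:Z.
  elim: k => [|k IH]; first by rewrite expr0 mulr1 subr0.
  rewrite exprSr mulrA vM ?mulf_neq0 ?expf_neq0 // -addn1 PoszD opprD addrA.
  exact: lerD.
have [/eqP|H0] := H (`|v c|%N.+1).
  by rewrite mulf_eq0 (negPf c0) expf_eq0 (negPf x0) andbF.
have := le_trans H0 (vk _); rewrite subr_ge0 -addn1 PoszD abszE lezD1 => H1.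
by have := lt_le_trans H1 (ler_norm (v c)); rewrite ltxx.
Qed.

End Products.

(** * Mori domains: t-maximal ideals, localization, the w-operation, finite character *)

Section Global.
Variables (K : fieldType) (A : set K).
Hypothesis fullA : full_ring A.
Hypothesis moriA : mori A.
Hypothesis nonfieldA : exists x, [/\ A x, x != 0 & ~ A x^-1].
Implicit Types (I J M P : set K).

Let sA : subring A. Proof. by case: fullA. Qed.
Let rA : rng A. Proof. by case: sA. Qed.
Let A1 : A 1. Proof. by case: sA. Qed.

Lemma common_denominator (s : seq K) :
  exists d, [/\ A d, d != 0 & forall x, x \in s -> A (d * x)].
Proof.
elim: s => [|x s [d [Ad d0 Hd]]]; first by exists 1; rewrite oner_neq0.
have [p [q [Ap Aq q0 E]]] := fullA.2 x.
exists (d * q); rewrite mulf_neq0 //; split=> //; first exact: rngM.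
move=> y; rewrite inE => /orP[/eqP->|/Hd Ay].
  rewrite (_ : d * q * x = d * p); first exact: rngM.
  by rewrite E; field.
by rewrite mulrAC; apply: rngM.
Qed.

Lemma span_ideal s : (exists2 x, x \in s & x != 0) -> ideal A (span A s).
Proof.
move=> [x xs x0]; split; first exact: span_submod.
  by exists x => //; apply: mem_span.
have [d [Ad d0 Hd]] := common_denominator s; exists d; split=> //.
move=> y /(span_min (I := [set y | A (d * y)])); apply=> //=.
split=> /=; first by rewrite mulr0; apply: rng0.
  by move=> *; rewrite mulrDr; apply: rngD.
by move=> *; rewrite mulrCA; apply: rngM.
Qed.

(** In a Mori domain I lies in the v-closure of a finitely generated subideal, which I contains when
    it is t-closed. *)
Lemma t_closed_divisorial I : integral_ideal A I -> t_op A I = I ->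
  divisorial A I.
Proof.
move=> iI tI; split=> //; apply/seteqP; split; last exact: v_op_sub.
have [s [nz Is sub]] := mori_fin_gen sA moriA iI.
have spI : span A s `<=` I by apply: span_min => //; case: iI => [[]].
have vI : v_op A (span A s) `<=` I.
  rewrite -[X in _ `<=` X]tI => x vx; exists (span A s) => //; split=> //.
  by split; [apply: span_ideal|exists s].
apply: subset_trans vI; rewrite -[X in _ `<=` X]v_op_idem.
exact: v_opS.
Qed.

Lemma divisorial_t_closed I : divisorial A I -> t_op A I = I.
Proof.
move=> [iI vI]; have [[mI [y Iy y0] _] IA] := iI; apply/seteqP; split.
  by move=> x [J [_ JI] vx]; rewrite -vI; apply: v_opS vx.
have H z x : I z -> z != 0 -> span A [:: z] x -> t_op A I x.
  move=> Iz z0 sx; exists (span A [:: z]); last exact: v_op_sub.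
  split; last by apply: span_min => // w; rewrite inE => /eqP->.
  by split; [apply: span_ideal; exists z; rewrite // inE|exists [:: z]].
move=> x Ix; have [->|x0] := eqVneq x 0.
  by apply: (H y) => //; case: (span_submod [:: y] sA).
by apply: (H x) => //; apply: mem_span; rewrite // inE.
Qed.

Lemma ideal_neq_ring I : integral_ideal A I -> ~ I 1 <-> I <> A.
Proof.
move=> [[[_ _ IZ] _ _] IA]; split=> [n1 E|n E]; first by apply: n1; rewrite E.
apply: n; apply/seteqP; split=> // x Ax.
by rewrite -[x]mulr1; apply: IZ.
Qed.

Lemma t_max_divisorial M : t_max A M -> divisorial A M.
Proof. by move=> [[iM _ tM] _]; apply: t_closed_divisorial. Qed.

Lemma t_max1 M : t_max A M -> ~ M 1.
Proof. by move=> [[iM nM _] _]; apply/ideal_neq_ring. Qed.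

Lemma exists_t_max I : divisorial A I -> ~ I 1 ->
  exists2 M, t_max A M & I `<=` M.
Proof.
move=> dI n1.
pose G J := [/\ divisorial A J, ~ J 1 & I `<=` J].
have [||M [[dM nM IM] max]] := @acc_max K (fun J => divisorial A J) G moriA.
- by move=> J [].
- by exists I; split.
exists M => //; have [iM vM] := dM; split.
  by split=> //; [apply/ideal_neq_ring|apply: divisorial_t_closed].
move=> J [iJ nJ tJ] MJ; apply: max => //; split.
- exact: t_closed_divisorial.
- exact/ideal_neq_ring.
- exact: subset_trans MJ.
Qed.

Lemma t_max_eq M M' : t_max A M -> t_max A M' -> M `<=` M' -> M = M'.
Proof. by move=> [_ max] [pM' _] MM'; rewrite (max M'). Qed.

Lemma divisorial_proper M : divisorial A M -> ~ M 1 -> proper_ideal A M.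
Proof.
move=> [[[mM _ _] MA] _] n1; have [_ _ MZ] := mM; split=> //; split.
- by case: mM.
- by move=> x y; apply: submodB mM.
- by move=> x y /MA Ax; apply: MZ.
Qed.

Lemma t_max_proper M : t_max A M -> proper_ideal A M.
Proof.
by move=> tM; apply: divisorial_proper; [apply: t_max_divisorial|apply: t_max1].
Qed.

(** This colon is the ideal of denominators of x; the element 1 in the set keeps it inside A. *)
Lemma divisorial_colon1 x : (exists2 y, A y & y != 0 /\ A (y * x)) ->
  divisorial A (colon A [set z | z = 1 \/ z = x]).
Proof.
move=> [y Ay [y0 Ayx]]; apply: divisorial_colon => //.
  by move=> z Hz; rewrite -[z]mulr1; apply: Hz; left.
by exists y => // z [->|->]; rewrite ?mulr1.
Qed.

Lemma colon1P x z : colon A [set w | w = 1 \/ w = x] z <-> A z /\ A (z * x).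
Proof.
split=> [H|[Az Azx] w [->|->]]; rewrite ?mulr1 //.
by split; [rewrite -[z]mulr1|]; apply: H; [left|right].
Qed.

(** If x is not in M, the v-closure of M + A x contains 1. For z in (A : M), y z multiplies M + A x
    into A, hence y z is in A; so y is in M^v = M. *)
Lemma t_max_prime M : t_max A M -> prime_ideal A M.
Proof.
move=> tM; have pM := t_max_proper tM; split=> // x y Ax Ay Mxy.
have [[[mM [m0 Mm0 m00] _] MA] vM] := t_max_divisorial tM.
have [Mx|nx] := pselect (M x); [by left|right].
pose Q := v_op A [set z | exists m a, [/\ M m, A a & z = m + a * x]].
have sub : [set z | exists m a, [/\ M m, A a & z = m + a * x]] `<=` A.
  by move=> _ [m [a [Mm Aa ->]]]; apply: rngD => //; [apply: MA|apply: rngM].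
have MQ : M `<=` Q.
  move=> m Mm; apply: v_op_sub; exists m, 0.
  by rewrite mul0r addr0; split=> //; apply: rng0.
have dQ : divisorial A Q.
  apply: divisorial_colon => //.
    by apply: v_op_min => //; apply: v_op_ring.
  by exists m0 => //; apply: MQ.
have Qx : Q x.
  apply: v_op_sub; exists 0, 1; rewrite mul1r add0r.
  by split=> //; case: mM.
have Q1 : Q 1.
  apply: contrapT => nQ1; apply: nx.
  have [N tN QN] := exists_t_max dQ nQ1.
  by rewrite (t_max_eq tM tN (subset_trans MQ QN)); apply: QN.
rewrite -vM => z Hz; rewrite -[y]mul1r -mulrA.
apply: Q1 => w [m [a [Mm Aa ->]]].
rewrite mulrDr; apply: rngD => //.
  by rewrite -mulrA; apply: rngM => //; apply: Hz.
rewrite (_ : y * z * (a * x) = a * (z * (x * y))); last by ring.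
by apply: rngM => //; apply: Hz.
Qed.

Lemma nonzero_t_max M : t_max A M -> exists2 x, M x & x != 0.
Proof. by case=> [[[[]]]]. Qed.

Lemma ex_t_max : exists M, t_max A M.
Proof.
have [x [Ax x0 nx]] := nonfieldA.
have [||M tM _] := @exists_t_max (colon A [set x^-1]); last by exists M.
  apply: divisorial_colon => //.
    move=> y /(_ _ erefl) H; rewrite -[y](divfK x0).
    exact: rngM.
  by exists x => // _ ->; rewrite mulfV.
by move=> /(_ _ erefl); rewrite mul1r.
Qed.

(** Were x outside A, its ideal of denominators would be proper and divisorial, hence inside some
    t-maximal M, against x in A_M. *)
Lemma t_max_inter x : (forall M, t_max A M -> localize A A M x) -> A x.
Proof.
move=> H; have [p [q [Ap Aq q0 E]]] := fullA.2 x.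
have d : divisorial A (colon A [set z | z = 1 \/ z = x]).
  apply: divisorial_colon1; exists q => //; split=> //.
  by rewrite E mulrC divfK.
have [/colon1P[_]|n1] := pselect (colon A [set z | z = 1 \/ z = x] 1).
  by rewrite mul1r.
have [M tM sub] := exists_t_max d n1.
have [y [w [Ay Aw nw Ex]]] := H M tM; case: (nw); apply/sub/colon1P.
split=> //; rewrite Ex mulrC divfK //.
exact: prime_neq0 (t_max_prime tM) nw.
Qed.

Lemma localize_full M : t_max A M -> full_ring (localize A A M).
Proof.
move=> tM; have pM := t_max_prime tM; split; first exact: localize_subring.
have sub := @sub_localize _ A A M sA pM.
move=> z; have [x [y [Ax Ay y0 ->]]] := fullA.2 z.
by exists x, y; split=> //; apply: sub.
Qed.

Lemma localize_clear M (s : seq K) : t_max A M ->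
    (forall x, x \in s -> localize A A M x) ->
  exists t, [/\ A t, ~ M t & forall x, x \in s -> A (t * x)].
Proof.
move=> tM; have pM := t_max_prime tM; elim: s => [|x s IH] H.
  by exists 1; split=> //; apply: t_max1.
have [|t [At nt Ht]] := IH; first by move=> y ys; apply: H; rewrite inE ys orbT.
have /(localizeP _ (submod_self sA) pM)[u [Au nu Aux]] := H x (mem_head _ _).
exists (t * u); split; [exact: rngM|exact: (primeM pM At Au nt nu)|].
move=> y; rewrite inE => /orP[/eqP->|/Ht Aty].
  by rewrite -mulrA; apply: rngM.
by rewrite mulrAC; apply: rngM.
Qed.

(** A divisorial ideal C of A_M is determined by its trace on A, and that trace is divisorial: it
    lies in the v-closure of finitely many of its elements s, and for y in (A_M : C) one element
    outside M clears the denominators of all products y s. *)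
Lemma localize_mori M : t_max A M -> mori (localize A A M).
Proof.
move=> tM; have pM := t_max_prime tM; set D := localize A A M.
have sD : subring D by apply: localize_subring.
have AD : A `<=` D by apply: sub_localize.
move=> C dC incC.
have cD n : submodule D (C n) by have [[[[]]]] := dC n.
have [||N HN] := moriA (I := fun n => C n `&` A).
- move=> n; have [[[_ [x Cx x0] _] CD] vC] := dC n; have [C0 CDD CZ] := cD n.
  have iJ : integral_ideal A (C n `&` A).
    apply: integral_idealP => //.
      split; first by split=> //; apply: rng0.
        by move=> y z [? ?] [? ?]; split; [apply: CDD|apply: rngD].
      by move=> a y Aa [? ?]; split; [apply: CZ => //; apply: AD|apply: rngM].
    have /(localizeP _ (submod_self sA) pM)[t [At nt Atx]] := CD _ Cx.
    exists (t * x); last by rewrite mulf_neq0 // (prime_neq0 pM nt).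
    by split=> //; apply: CZ => //; apply: AD.
  split=> //; apply/seteqP; split; last exact: v_op_sub.
  have [s [nz sJ Js]] := mori_fin_gen sA moriA iJ.
  move=> z vz; split; last first.
    by apply: v_op_min vz; [move=> ? []|apply: v_op_ring].
  rewrite -vC => y Hy.
  have [t [At nt Ht]] : exists t, [/\ A t, ~ M t &
      forall x, x \in [seq y * w | w <- s] -> A (t * x)].
    apply: localize_clear => // _ /mapP[w /sJ[Cw _] ->].
    exact: Hy.
  apply/(localizeP _ (submod_self sA) pM); exists t; split=> //.
  have vz' : v_op A (span A s) z.
    by rewrite -v_op_idem; apply: v_opS Js z vz.
  rewrite mulrCA; apply: vz' => w /(span_min (I := [set w | A (t * y * w)])).
  apply=> /=; last by move=> b bs; rewrite -mulrA; apply/Ht/map_f.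
  split=> /=; first by rewrite mulr0; apply: rng0.
    by move=> *; rewrite mulrDr; apply: rngD.
  by move=> *; rewrite mulrCA; apply: rngM.
- by move=> n x [Cx Ax]; split=> //; apply: incC.
have sub n m : C n `&` A `<=` C m -> C n `<=` C m.
  move=> H x Cx; have [[_ CD] _] := dC n.
  have /(localizeP _ (submod_self sA) pM)[t [At nt Atx]] := CD _ Cx.
  have t0 := prime_neq0 pM nt.
  rewrite -[x](mulKf t0); have [_ _ CZ] := cD m; apply: CZ.
    by exists 1, t; rewrite mul1r.
  by apply: H; split=> //; have [_ _] := cD n; apply=> //; apply: AD.
exists N => n /HN E; apply/seteqP; split; apply: sub.
  by rewrite E => ? [].
by rewrite -E => ? [].
Qed.

(** Take z in (A : M) but not in A. Its ideal of denominators is proper, divisorial and contains M,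
    so it equals M and z has no denominator outside M. *)
Lemma localize_nontrivial M : t_max A M -> exists2 z, ~ localize A A M z &
  forall x, localize A M M x -> localize A A M (z * x).
Proof.
move=> tM; have pM := t_max_prime tM; have [iM vM] := t_max_divisorial tM.
have [z Hz nz] : exists2 z, colon A M z & ~ A z.
  apply: contrapT => H; apply: (t_max1 tM); rewrite -vM => z Hz.
  by rewrite mul1r; apply: contrapT => nz; apply: H; exists z.
exists z; last first.
  move=> _ [x [t [Mx At nt ->]]]; exists (z * x), t; rewrite mulrA; split=> //.
  exact: Hz.
move=> /(localizeP _ (submod_self sA) pM)[t [At nt Atz]]; apply: (nt).
have d : divisorial A (colon A [set w | w = 1 \/ w = z]).
  apply: divisorial_colon1; exists t => //; split=> //.
  exact: prime_neq0 pM nt.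
have n1 : ~ colon A [set w | w = 1 \/ w = z] 1.
  by move=> /colon1P[_]; rewrite mul1r.
have [M' tM' sub] := exists_t_max d n1.
rewrite (t_max_eq tM tM'); first by apply/sub/colon1P.
move=> x Mx; apply/sub/colon1P; split; last by rewrite mulrC; apply: Hz.
by case: iM => _; apply.
Qed.


Lemma localize_min M I L : t_max A M -> submodule (localize A A M) L ->
  I `<=` L -> localize A I M `<=` L.
Proof.
move=> tM [_ _ LZ] IL _ [x [t [Ix At nt ->]]]; rewrite mulrC.
by apply: LZ; [exists 1, t; rewrite mul1r|apply: IL].
Qed.

Lemma t_max_localize_submod M I : t_max A M -> submodule A I ->
  submodule (localize A A M) (localize A I M).
Proof. by move=> /t_max_prime pM; apply: localize_submod. Qed.

Lemma t_max_sub_localize M I : t_max A M -> I `<=` localize A I M.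
Proof. by move=> /t_max_prime pM; apply: sub_localize. Qed.

Lemma t_max_localizeP M I z : t_max A M -> submodule A I ->
  localize A I M z <-> exists t, [/\ A t, ~ M t & I (t * z)].
Proof. by move=> /t_max_prime pM mI; apply: localizeP. Qed.

Lemma w_op_sub I : I `<=` w_op A I.
Proof. by move=> x Ix M tM; apply: t_max_sub_localize. Qed.

Lemma w_op_submod I : submodule A I -> submodule A (w_op A I).
Proof.
move=> mI; have mL M (tM : t_max A M) := t_max_localize_submod tM mI.
split.
- by move=> M tM; case: (mL M tM).
- by move=> x y Hx Hy M tM; have [_ LD _] := mL M tM; apply: LD; [apply: Hx|apply: Hy].
- move=> a x Aa Hx M tM; have [_ _ LZ] := mL M tM; apply: LZ; last exact: Hx.
  exact: t_max_sub_localize.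
Qed.

Lemma w_op_min I J : submodule A I -> J `<=` w_op A I -> w_op A J `<=` w_op A I.
Proof.
move=> mI JI x Hx M tM; apply: (localize_min tM (t_max_localize_submod tM mI)) (Hx M tM).
by move=> y /JI; apply.
Qed.

Lemma w_op_sub_v I : submodule A I -> w_op A I `<=` v_op A I.
Proof.
move=> mI x Hx y Hy; apply: t_max_inter => M tM.
have [t [At nt It]] := (t_max_localizeP x tM mI).1 (Hx M tM).
apply/(t_max_localizeP _ tM (submod_self sA)); exists t; split=> //.
by rewrite mulrA mulrC; apply: Hy.
Qed.

Lemma w_op_bound I d x : A d -> (forall y, I y -> A (d * y)) -> w_op A I x ->
  A (d * x).
Proof.
move=> Ad Hd Hx; apply: t_max_inter => M /[dup] tM /Hx.
move=> [y [t [Iy At nt ->]]]; exists (d * y), t; rewrite mulrA; split=> //.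
exact: Hd.
Qed.

Lemma localize_w_op M I : t_max A M -> submodule A I ->
  localize A (w_op A I) M = localize A I M.
Proof.
move=> tM mI; apply/seteqP; split; last exact/localizeS/w_op_sub.
by apply: localize_min => //; [apply: t_max_localize_submod|move=> y; apply].
Qed.

Lemma localize_span M s : t_max A M ->
  localize A (span A s) M = span (localize A A M) s.
Proof.
move=> tM; have sD : subring (localize A A M) by case: (localize_full tM).
have AD : A `<=` localize A A M by apply: t_max_sub_localize.
apply/seteqP; split.
  apply: localize_min => //; first exact: span_submod.
  exact: span_coefS.
apply: span_min; first by apply: t_max_localize_submod => //; apply: span_submod.
by move=> x xs; apply: t_max_sub_localize => //; apply: mem_span.
Qed.

(* I = I (I J) locally, so the determinant trick gives 1 in I J E. *)
Lemma clifford_w_finitely_stable M : clifford_regular A (w_op A) ->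
  t_max A M -> finitely_stable (localize A A M).
Proof.
move=> cl tM s nz; set D := localize A A M.
have sD : subring D by case: (localize_full tM).
have [rD D1] := sD.
have mJ := span_submod s sA; have [J' _ E] := cl _ (span_ideal nz).
set J := span A s in mJ E *; set I := span D s.
have mI : submodule D I := span_submod s sD; have [I0 ID IZ] := mI.
have LI : localize A J M = I := localize_span s tM.
have JI : J `<=` I by rewrite -LI; apply: t_max_sub_localize.
have mJJ := mul_submod J' (mul_submod J mJ).
have LJ : localize A (mul (mul J J) J') M = I.
  by rewrite -LI -(localize_w_op tM mJ) E localize_w_op.
set U := self_inverse I.
have mU : submodule D U.
  split; first by move=> x y _ _; rewrite !mul0r.
    by move=> u v Hu Hv x y Ix Iy; rewrite !mulrDl; apply: ID; [apply: Hu|apply: Hv].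
  by move=> d u Dd Hu x y Ix Iy; rewrite -!mulrA; apply: IZ => //; rewrite mulrA; apply: Hu.
have J'U j : J' j -> U j.
  have H x y : J x -> J y -> J' j -> I (j * x * y).
    move=> Jx Jy Jj; rewrite -LJ; apply: t_max_sub_localize => //.
    by rewrite -mulrA mulrC; apply: mem_mul => //; apply: mem_mul.
  move=> Jj x y; rewrite -LI => -[x0 [t [Jx At nt ->]]] [y0 [t' [Jy At' nt' ->]]].
  have Dinv w : A w -> ~ M w -> D w^-1 by move=> Aw nw; exists 1, w; rewrite mul1r.
  rewrite (_ : _ * _ = t^-1 * (t'^-1 * (j * x0 * y0))); last by ring.
  by rewrite LI; do 2 (apply: (IZ) => //; first exact: Dinv); apply: H.

have [U0 UD UZ] := mU.
(* This makes U I closed under products, so that the determinant trick can be run with coefficients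
   in U I. *)
have LU l v : span U s l -> U v -> U (l * v).
  move=> [u [Hu ->]] Hv x y Ix Iy; rewrite !mulr_suml.
  apply: (submod_sum _ mI) => i _.
  rewrite (_ : _ * _ = u i * s`_i * (v * x * y)); last by ring.
  apply: Hu; last exact: Hv.
  by apply: mem_span => //; apply: mem_nth.
have LD d l : D d -> span U s l -> span U s (d * l).
  move=> Dd [u [Hu ->]]; exists (fun i => d * u i); split=> [i|]; first exact: UZ.
  by rewrite mulr_sumr; apply: eq_bigr => i _; rewrite mulrA.
have L0 : span U s 0.
  by exists (fun=> 0); split=> //; rewrite big1 // => i _; rewrite mul0r.
have rL : rng (span U s).
  split=> //.
    move=> _ _ [u [Hu ->]] [v [Hv ->]]; exists (fun i => u i - v i).
    split=> [i|]; first exact: (submodB sD mU).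
    by rewrite -sumrB; apply: eq_bigr => i _; rewrite mulrBl.
  move=> l _ Ll [v [Hv ->]]; exists (fun i => l * v i); split=> [i|].
    exact: LU.
  by rewrite mulr_sumr; apply: eq_bigr => i _; rewrite mulrA.
(* It remains to see that I lies in (U I) I: locally I is J J J', and J' lies in U. *)
apply: (nakayama rL nz) => x xs.
pose Q := [set y | span (span U s) s y].
have QD : submodule D Q.
  split.
  - by exists (fun=> 0); split=> //; rewrite big1 // => i _; rewrite mul0r.
  - move=> _ _ [u [Hu ->]] [v [Hv ->]]; exists (fun i => u i + v i).
    split=> [i|]; first exact: rngD.
    by rewrite -big_split; apply: eq_bigr => i _; rewrite mulrDl.
  - move=> d _ Dd [u [Hu ->]]; exists (fun i => d * u i).
    split=> [i|]; first exact: LD.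
    by rewrite mulr_sumr; apply: eq_bigr => i _; rewrite mulrA.
have [Q0 QA _] := QD.
have : I x by apply: mem_span.
rewrite -LJ; apply: (localize_min tM QD).
have AD a : A a -> D a by apply: t_max_sub_localize.
apply: mul_min => // y j Hy Jj.
apply: (mul_min (Q := [set y | Q (y * j)])) Hy => /=; first by rewrite mul0r.
  by move=> *; rewrite mulrDl; apply: QA.
move=> _ q2 [c [Ac ->]] [d [Ad E2]].
have Lq : span U s (q2 * j).
  exists (fun i => d i * j); split=> [i|]; first by apply: UZ; [apply: AD|apply: J'U].
  by rewrite E2 mulr_suml; apply: eq_bigr => i _; rewrite mulrAC.
exists (fun i => c i * (q2 * j)); split=> [i|]; first by apply: LD => //; apply: AD.
by rewrite -mulrA mulr_suml; apply: eq_bigr => i _; rewrite mulrAC.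
Qed.

(** With W = I^w, the witness is (E : W). Locally 1 lies in W (E : W); multiplying this by an
    element i of I puts i in I I (E : W). *)
Lemma w_stable_clifford : stable A (w_op A) -> clifford_regular A (w_op A).
Proof.
move=> st I iI; have [mI [i0 Ii0 i00] [d [Ad d0 Hd]]] := iI.
have := st I iI; rewrite /=.
set W := w_op A I; set E := colon W W; set J := colon E W => EJ.
have mW : submodule A W := w_op_submod mI.
have mE : submodule A E := colon_submodule W mW.
have mJ : submodule A J := colon_submodule W mE.
have IW : I `<=` W := @w_op_sub I.
have AE : A `<=` E by move=> a Aa y Wy; case: mW => _ _; apply.
have dW y : W y -> A (d * y) by apply: w_op_bound.
have [_ _ IZ] := mI.
exists J.
  split=> //.
    by exists d => // y /dW Ay; apply: AE.
  (* For j in J, j i0 is in E, so it maps d i0, an element of W, into W; the remaining factor d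
     takes W into A. *)
  exists (d * (d * i0) * i0); split.
  - by rewrite -mulrA mulrCA; apply: rngM => //; apply: Hd.
  - by rewrite !mulf_neq0.
  move=> j Jj; have Ej := Jj _ (IW _ Ii0).
  have Wi : W (d * i0) by apply: IW; apply: IZ.
  rewrite (_ : _ * _ = d * (j * i0 * (d * i0))); last by ring.
  by apply: dW; apply: Ej.
have mIIJ := mul_submod J (mul_submod I mI).
have sub : mul (mul I I) J `<=` W.
  have [W0 WD WZ] := mW.
  apply: mul_min => // y j Hy Jj.
  apply: (mul_min (Q := [set y | W (y * j)])) Hy => /=; first by rewrite mul0r.
    by move=> *; rewrite mulrDl; apply: WD.
  move=> x y' Ix Iy; rewrite (_ : x * y' * j = j * x * y'); last by ring.
  by apply: (Jj x (IW _ Ix)); apply: IW.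
apply/seteqP; split; last exact: w_op_min.
apply: w_op_min => // i Ii M tM.
have mL := t_max_localize_submod tM mIIJ; have [L0 LD LZ] := mL.
have : localize A (mul W J) M 1.
  by have : E 1 by [move=> y; rewrite mul1r]; rewrite -EJ; apply.
have mWJ := mul_submod J mW.
move=> /(t_max_localizeP _ tM mWJ)[t [At nt]]; rewrite mulr1 => WJt.
have : localize A (mul (mul I I) J) M (i * t).
  apply: (mul_min (Q := [set y | localize A (mul (mul I I) J) M (i * y)])) WJt => /=.
  - by rewrite mulr0.
  - by move=> *; rewrite mulrDr; apply: LD.
  move=> w j /(_ M tM)[w0 [u [Iw Au nu ->]]] Jj.
  exists (i * w0 * j), u; split=> //; last by ring.
  by apply: mem_mul => //; apply: mem_mul.
move=> H; have -> : i = t^-1 * (i * t).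
  by rewrite mulrCA mulVf ?mulr1 //; apply: prime_neq0 (t_max_prime tM) nt.
by apply: LZ => //; exists 1, t; rewrite mul1r.
Qed.

(** Finite intersections [cap l] of t-maximal ideals containing x descend as l grows, so the
    integral divisorial ideals x (A : [cap l]) ascend. When one of them is maximal, every t-maximal
    M containing x contains [cap l], hence by primality equals a member of l. *)
Lemma t_max_finite x : A x -> x != 0 -> finite_set [set M | t_max A M /\ M x].
Proof.
move=> Ax x0.
have dvM M : t_max A M -> v_op A M = M by move=> /t_max_divisorial[].
pose cap (l : seq (set K)) := [set y | A y /\ forall M, M \in l -> M y].
pose X l := colon A [set z | exists2 y, cap l y & z = y / x].
pose ok (l : seq (set K)) := forall M, M \in l -> t_max A M /\ M x.
have vcap l : ok l -> v_op A (cap l) `<=` cap l.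
  move=> okl y vy; split.
    by apply: v_op_min vy; [move=> ? []|apply: v_op_ring].
  move=> M Ml; have [tM _] := okl M Ml; rewrite -(dvM M tM).
  by apply: v_opS vy => z [_]; apply.
pose G Y := exists2 l, ok l & Y = X l.
have [||_ [[l okl ->] max]] := @acc_max K (fun J => divisorial A J) G moriA.
- move=> _ [l okl ->]; apply: divisorial_colon => //.
    move=> y Hy; rewrite -[y]mulr1; apply: Hy; exists x; last by rewrite divff.
    by split=> // M /okl[].
  by exists x => // _ [y [Ay _] ->]; rewrite mulrC divfK.
- by exists (X [::]), [::].
apply: (sub_finite_set (B := [set` l])); last exact: finite_seq.
move=> M [tM Mx] /=; apply: contrapT => Ml.
have okMl : ok (M :: l) by move=> N; rewrite inE => /orP[/eqP->|/okl].
have E : X (M :: l) = X l.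
  apply: max; first by exists (M :: l).
  move=> y Hy _ [z [Az Hz] ->]; apply: Hy; exists z => //; split=> // N Nl.
  by apply: Hz; rewrite inE Nl orbT.
(* Equality of the dual ideals gives equality of the v-closures, and [cap (M :: l)] is its own
   v-closure. *)
have sub : cap l `<=` M.
  suff : cap l `<=` cap (M :: l).
    by move=> H y /H[_]; apply; rewrite inE eqxx.
  apply: subset_trans (vcap _ okMl); apply: (subset_trans (@v_op_sub _ A _)).
  apply: colonS => y Hy z Hz.
  have : X (M :: l) (y * x).
    by move=> _ [w Hw ->]; rewrite mulrA mulrAC mulfK //; apply: Hy.
  rewrite E => /(_ (z / x)); rewrite mulrA mulrAC mulfK //; apply.
  by exists z.
have pM := t_max_prime tM.
have [N Nl NM] : exists2 N, N \in l & N `<=` M.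
  elim: (l) okl sub {max E okMl Ml} => [|N l' IH] okl sub.
    by case: (t_max1 tM); apply: sub.
  have [NM|] := pselect (N `<=` M); first by exists N; rewrite // inE eqxx.
  move=> /existsNP[y /not_implyP[Ny nMy]].
  have [|z [Az Hz]|N' N'l ?] := IH; last by exists N'; rewrite // inE N'l orbT.
    by move=> N' N'l; apply: okl; rewrite inE N'l orbT.
  have Ay : A y by apply: (pideal_sub (t_max_proper (okl N _).1)); rewrite ?inE ?eqxx.
  apply: contrapT => nMz; apply: (primeM pM Ay Az nMy nMz).
  apply: sub; split=> [|N']; first exact: rngM.
  rewrite inE => /orP[/eqP->|N'l].
    by apply: (pidealMr (t_max_proper (okl N _).1)); rewrite ?inE ?eqxx.
  apply: (pidealM (t_max_proper (okl N' _).1)); rewrite ?inE ?N'l ?orbT //.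
  exact: Hz.
by apply: Ml; rewrite -(t_max_eq (okl N Nl).1 tM NM).
Qed.

Lemma t_max_unit_finite x : x != 0 -> finite_set [set M | t_max A M /\
  ~ (localize A A M x /\ localize A A M x^-1)].
Proof.
move=> x0; have [p [q [Ap Aq q0 E]]] := fullA.2 x.
have p0 : p != 0 by apply: contraNN x0 => /eqP p0; rewrite E p0 mul0r.
have fin : finite_set ([set M | t_max A M /\ M p] `|` [set M | t_max A M /\ M q]).
  by rewrite finite_setU; split; apply: t_max_finite.
apply: sub_finite_set fin => M [tM n]; apply: contrapT => /not_orP[n1 n2].
apply: n; rewrite E invf_div; split.
  by exists p, q; split=> // Mq; apply: n2.
by exists q, p; split=> // Mp; apply: n1.
Qed.

(** * Mori domains that are finitely stable at every t-maximal ideal *)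

Section LocallyStable.
Hypothesis fsA : forall M, t_max A M -> finitely_stable (localize A A M).

Lemma localize_stable M : t_max A M ->
  mori_stable_local (localize A A M) (localize A M M).
Proof.
move=> tM; split; [exact/localize_local/t_max_prime|exact: fsA|
  exact: localize_full|exact: localize_mori|exact: localize_nontrivial].
Qed.

(** For x in M and a nonzero a in P, some x^k is a multiple of a in A_M; clearing a denominator
    outside M, hence outside P, leaves x^k in P. *)
Lemma t_max_height_one M P : t_max A M -> prime_ideal A P ->
  (exists2 x, P x & x != 0) -> P `<=` M -> P = M.
Proof.
move=> tM pP [a Pa a0] PM; apply/seteqP; split=> // x Mx.
have Mx' : localize A M M x by apply: t_max_sub_localize.
have [k /(t_max_localizeP _ tM (submod_self sA))[t [At nt Dt]]] :=
  local_power (localize_stable tM) Mx' a0.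
have Ax := pideal_sub (t_max_proper tM) Mx.
have : P (t * x ^+ k).
  rewrite (_ : t * x ^+ k = t * (x ^+ k / a) * a); last by rewrite -mulrA divfK.
  exact: (pidealM pP.1).
move=> /(pP.2 _ _ At (subringX k sA Ax))[/PM//|].
exact: (primeX sA pP Ax).
Qed.

Lemma nonzero_primeP P : nonzero_prime A P ->
  prime_ideal A P /\ exists2 x, P x & x != 0.
Proof.
move=> [iP nP pr]; have [[mP nz _] PA] := iP; have [P0 PD PZ] := mP.
split=> //; split=> //; split=> //; [split=> //|exact/ideal_neq_ring].
  by move=> x y; apply: (submodB sA mP).
by move=> x y /PA Ax Py; apply: PZ.
Qed.

Lemma t_max_nonzero_prime M : t_max A M -> nonzero_prime A M.
Proof.
move=> tM; have [[iM nM _] _] := tM; have [_ pr] := t_max_prime tM.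
by split.
Qed.

Lemma t_dim_one : t_dim A 1.
Proof.
split.
  have [M tM] := ex_t_max; exists (fun=> M); split=> // i _.
  by split; [apply: t_max_nonzero_prime|case: tM => [[]]].
move=> [|[|m]] // [P [HP incP]]; exfalso.
have [Hp0 _] := HP 0%N isT; have [Hp1 t1] := HP 1%N isT.
have [pP0 nz0] := nonzero_primeP Hp0; have [pP1 nz1] := nonzero_primeP Hp1.
have [M tM PM] : exists2 M, t_max A M & P 1%N `<=` M.
  apply: exists_t_max; last exact: pideal1 pP1.1.
  by apply: t_closed_divisorial => //; case: Hp1.
have [P01 nP] := incP 0%N isT.
have E := t_max_height_one tM pP0 nz0 (subset_trans P01 PM).
by apply: nP; rewrite E.
Qed.


(* The generator may be taken in I, since denominators are units. *)
Lemma localize_generator M I : t_max A M -> ideal A I -> exists f,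
  [/\ f != 0, I f, forall x, localize A I M x -> integral_elt (localize A A M) (x / f) &
   forall x y, localize A I M x -> localize A I M y ->
     localize A I M (x * y / f)].
Proof.
move=> tM [mI [x0 Ix0 x00] [d [Ad d0 Hd]]].
have mL := t_max_localize_submod tM mI.
have sub := @t_max_sub_localize M I tM; have pM := t_max_prime tM.
have sD := (localize_full tM).1.
have [rB B1] := integral_subring sD; have DB := sub_integral sD.
have [||h [h0 Ih Bh mulh]] := local_generator (localize_stable tM) mL.
- by exists x0 => //; apply: sub.
- exists d => // x [y [t [Iy At nt ->]]]; apply: DB.
  by exists (d * y), t; rewrite mulrA; split=> //; apply: Hd.
have [t [At nt Ith]] := (t_max_localizeP h tM mI).1 Ih.
have t0 := prime_neq0 pM nt.
have Dt : localize A A M t^-1 by exists 1, t; rewrite mul1r.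
exists (t * h); rewrite mulf_neq0 //; split=> // [x Lx|x y Lx Ly].
  rewrite (_ : x / (t * h) = t^-1 * (x / h)); last by field; rewrite h0 t0.
  by apply: rngM => //; [apply: DB|apply: Bh].
rewrite (_ : x * y / (t * h) = t^-1 * (x * y / h)); last by field; rewrite h0 t0.
by case: mL => _ _; apply => //; apply: mulh.
Qed.

(** The product of the individual witnesses serves all N at once and stays outside the prime M. *)
Lemma finite_avoid M (X : set (set K)) (Q : set K -> K -> Prop) : t_max A M ->
    finite_set X -> (forall N s t, A t -> Q N s -> Q N (t * s)) ->
    (forall N, X N -> exists s, [/\ A s, ~ M s & Q N s]) ->
  exists s, [/\ A s, ~ M s & forall N, X N -> Q N s].
Proof.
move=> tM /finite_seqP[l ->] QM; elim: l => [|N l IH] H.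
  by exists 1; split=> //; exact: t_max1.
have [|s [As ns Hs]] := IH.
  by move=> N' /= N'l; apply: H; rewrite /= inE N'l orbT.
have [|t [At nt Ht]] := H N; first by rewrite /= inE eqxx.
exists (s * t); split; [exact: rngM|exact: (primeM (t_max_prime tM) As At ns nt)|].
move=> N' /=; rewrite inE => /orP[/eqP->|/Hs H']; first exact: QM.
by rewrite mulrC; apply: QM.
Qed.

(** If f in I generates I over its endomorphism ring at M, it suffices to find s outside M with s W
    W inside f W, that is, s/f in (E : W). The condition on s is local, and only finitely many
    t-maximal ideals impose one. *)
Lemma w_stable : stable A (w_op A).
Proof.
move=> I iI /=; have [mI [x0 Ix0 x00] [d [Ad d0 Hd]]] := iI.
set W := w_op A I; set E := colon W W.
have mW : submodule A W := w_op_submod mI.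
have mE : submodule A E := colon_submodule W mW.
have IW : I `<=` W := @w_op_sub I.
set J := colon E W; have mJ : submodule A J := colon_submodule W mE.
have mWJ : submodule A (mul W J) := mul_submod J mW.
have WJE : mul W J `<=` E.
  by case: mE => E0 ED _; apply: mul_min => // w j Ww Jj; rewrite mulrC; apply: Jj.
have EJ e j : E e -> J j -> J (e * j).
  move=> Ee Jj w Ww w' Ww'; rewrite -!mulrA; apply: Ee; rewrite mulrA.
  exact: Jj.
apply/seteqP; split.
  move=> y Hy w Ww M tM; have [x [t [Hx At nt ->]]] := Hy M tM.
  have [_ _ LZ] := t_max_localize_submod tM mI.
  rewrite (_ : x / t * w = t^-1 * (x * w)); last by ring.
  apply: LZ; first by exists 1, t; rewrite mul1r.
  exact: (WJE _ Hx w Ww M tM).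
move=> e Ee M tM; have [f [f0 If Bf mulf]] := localize_generator tM iI.
suff [s [As ns Js]] : exists s, [/\ A s, ~ M s & J (s / f)].
  apply/(t_max_localizeP _ tM mWJ); exists s; split=> //.
  rewrite (_ : s * e = f * (e * (s / f))); last by field.
  by apply: mem_mul; [apply: IW|apply: EJ].
(* Away from X both f and d are units at N, so w/f = f^-1 d^-1 (d w) is already in A_N for w in
   W. *)
pose X := [set N | t_max A N /\ ~ (localize A A N f /\ localize A A N f^-1)] `|`
  [set N | t_max A N /\ ~ (localize A A N d /\ localize A A N d^-1)].
pose Q N s := t_max A N -> forall w w', localize A I N w -> localize A I N w' ->
  localize A I N (s * (w * w' / f)).
have [|||s [As ns Hs]] := @finite_avoid M X Q tM.
- by rewrite finite_setU; split; apply: t_max_unit_finite.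
- move=> N s t At H tN w w' Lw Lw'; rewrite -mulrA.
  have [_ _ LZ] := t_max_localize_submod tN mI.
  by apply: LZ; [apply: t_max_sub_localize|apply: H].
- move=> N _; have [NM|NM] := pselect (N = M).
    exists 1; split=> //; first exact: t_max1.
    by rewrite /Q NM => _ w w' Lw Lw'; rewrite mul1r; apply: mulf.
  have [tN|ntN] := pselect (t_max A N); last first.
    by exists 1; split=> //; exact: t_max1.
  have [g [g0 Ig _ mulg]] := localize_generator tN iI.
  have [x Nx nMx] : exists2 x, N x & ~ M x.
    apply: contrapT => H; apply: NM; apply: t_max_eq => // x Nx.
    by apply: contrapT => nMx; apply: H; exists x.
  have fg0 : f / g != 0 by rewrite mulf_neq0 // invr_neq0.
  (* A power of x replaces the generator g at N by f, and x is outside M. *)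
  have [k Dk] := local_power (localize_stable tN) (t_max_sub_localize tN Nx) fg0.
  exists (x ^+ k); have Ax := pideal_sub (t_max_proper tN) Nx; split.
  + exact: subringX.
  + by move=> /(primeX sA (t_max_prime tM) Ax).
  move=> _ w w' Lw Lw'.
  rewrite (_ : _ * _ = x ^+ k / (f / g) * (w * w' / g)); last first.
    by field; rewrite f0 g0.
  have [_ _ LZ] := t_max_localize_submod tN mI.
  by apply: LZ => //; apply: mulg.
exists s; split=> // w Ww w' Ww' N tN.
rewrite (_ : s / f * w * w' = s * (w * w' / f)); last by ring.
have [XN|nX] := pselect (X N); first by apply: Hs => //; [apply: Ww|apply: Ww'].
have mL := t_max_localize_submod tN mI; have [_ _ LZ] := mL.
have [rD D1] := (localize_full tN).1.
move: nX => /not_orP[/not_andP[//|/contrapT[_ Vf]] /not_andP[//|/contrapT[_ Vd]]].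
rewrite (_ : s * (w * w' / f) = s * (f^-1 * (d^-1 * (d * w))) * w'); last first.
  by field; rewrite f0 d0.
apply: LZ; last exact: Ww'.
have Dw : A (d * w) by apply: w_op_bound Ww.
apply: rngM => //; first exact: t_max_sub_localize.
do 2 apply: rngM => //; exact: t_max_sub_localize.
Qed.

(** For the converse take J = A + A x: at each M the relation x^2 = r + t x over A_M makes J_M
    stable under x. *)
Lemma w_integral_closureP x : w_integral_closure A x <->
  forall M, t_max A M -> integral_elt (localize A A M) x.
Proof.
split=> [[J [iJ [s EJ]] Hx] M tM|H].
  have [mJ [y Jy y0] _] := iJ; exists s; split.
    apply: contrapT => n; move: Jy; rewrite EJ => -[c [_ E]].
    move: y0; rewrite E big1 ?eqxx // => i _; have [->|si] := eqVneq s`_i 0.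
      by rewrite mulr0.
    by case: n; exists s`_i => //; apply: mem_nth.
  move=> z zs; rewrite -(localize_span s tM) -EJ.
  apply: (Hx z _ M tM); apply: w_op_sub.
  by rewrite EJ; apply: mem_span.
have iJ : ideal A (span A [:: 1; x]).
  by apply: span_ideal; exists 1; rewrite ?oner_neq0 // inE eqxx.
exists (span A [:: 1; x]).
  by split=> //; exists [:: 1; x].
move=> y Hy M tM; set J := span A [:: 1; x] in iJ Hy *.
have [mJ _ _] := iJ; have mL := t_max_localize_submod tM mJ.
have [L0 LD LZ] := mL; have [rD D1] := (localize_full tM).1.
have L1 : localize A J M 1.
  by apply: t_max_sub_localize => //; apply: mem_span; rewrite // inE eqxx.
have Lx : localize A J M x.
  by apply: t_max_sub_localize => //; apply: mem_span; rewrite // !inE eqxx orbT.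
apply: (localize_min (L := [set y | localize A J M (x * y)])) (Hy M tM) => //=.
  split=> /=; first by rewrite mulr0.
    by move=> *; rewrite mulrDr; apply: LD.
  by move=> *; rewrite mulrCA; apply: LZ.
have sub : J `<=` span (localize A A M) [:: 1; x].
  by apply: span_coefS; apply: t_max_sub_localize.
apply: (subset_trans sub).
apply: span_min => /=.
  split=> /=; first by rewrite mulr0.
    by move=> *; rewrite mulrDr; apply: LD.
  by move=> *; rewrite mulrCA; apply: LZ.
move=> z; rewrite !inE => /orP[] /eqP->; first by rewrite mulr1.
have [r [t [Dr Dt E]]] := local_quadratic (localize_stable tM) (H M tM).
by rewrite -expr2 E -[r]mulr1; apply: LD; apply: LZ.
Qed.

(* The valuation rings above the t-maximal ideals, two (possibly equal) for
   each of them. *)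
Lemma w_integral_closure_dvrs : exists F1 F2 : set K -> set K,
  (forall M, t_max A M -> dvr (F1 M) /\ dvr (F2 M)) /\
  forall M, t_max A M -> integral_elt (localize A A M) = F1 M `&` F2 M.
Proof.
have /choice[F HF] M : exists VV : set K * set K, t_max A M ->
   (dvr VV.1 /\ dvr VV.2) /\ integral_elt (localize A A M) = VV.1 `&` VV.2.
  have [tM|n] := pselect (t_max A M); last by exists (set0, set0).
  have [V1 [P1 [V2 [P2 [[_ d1] [_ d2] E _ _]]]]] :=
    local_two_dvr (localize_stable tM).
  by exists (V1, V2).
exists (fun M => (F M).1), (fun M => (F M).2).
by split=> M /HF[].
Qed.

(** An element that is a unit of A_M is a unit in both DVRs above M, so finite character is
    inherited from the t-maximal ideals. *)
Lemma krull_w_integral_closure : krull (w_integral_closure A).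
Proof.
have [F1 [F2 [dF EF]]] := w_integral_closure_dvrs.
have DF M V : t_max A M -> V = F1 M \/ V = F2 M -> localize A A M `<=` V.
  move=> tM HV x Dx; have := sub_integral (localize_full tM).1 Dx.
  by rewrite EF // => -[]; case: HV => ->.
exists [set V | exists2 M, t_max A M & V = F1 M \/ V = F2 M]; split.
- by move=> V [M /dF[d1 d2] [->|->]].
- apply/seteqP; split=> x.
    move=> /w_integral_closureP H V [M tM HV].
    by have := H M tM; rewrite EF // => -[]; case: HV => ->.
  move=> H; apply/w_integral_closureP => M tM; rewrite EF //.
  by split; apply: H; exists M => //; [left|right].
move=> x x0; have fin := t_max_unit_finite x0.
have fin' : finite_set (F1 @` [set M | t_max A M /\
    ~ (localize A A M x /\ localize A A M x^-1)] `|`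
  F2 @` [set M | t_max A M /\ ~ (localize A A M x /\ localize A A M x^-1)]).
  by rewrite finite_setU; split; apply: finite_image.
apply: sub_finite_set fin' => V [[M tM HV] n].
have n' : ~ (localize A A M x /\ localize A A M x^-1).
  by move=> [H1 H2]; apply: n; split; apply: (DF M V tM HV).
by case: HV => ->; [left|right]; exists M.
Qed.

(** If x multiplies I^v into itself, then c x^k is in A for all k and a fixed nonzero c, so x is in
    every DVR above A. Conversely, stability of J^w under x passes to J^v. *)
Lemma w_integral_closure_complete :
  w_integral_closure A = complete_integral_closure A.
Proof.
have [F1 [F2 [dF EF]]] := w_integral_closure_dvrs.
apply/seteqP; split=> x.
  move=> [J [iJ [s EJ]] Hx]; exists J => // z Hz y Hy.
  rewrite -mulrA mulrCA; apply: Hz => j Jj; have [mJ _ _] := iJ.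
  have : v_op A J (x * j) by apply: w_op_sub_v => //; apply/Hx/w_op_sub.
  by move=> /(_ y Hy); rewrite (_ : x * y * j = x * j * y) //; ring.
move=> [I [mI [i Ii i0] [d [Ad d0 Hd]]] Hx].
have Axk k : A (d * i * x ^+ k).
  have : v_op A I (x ^+ k * i).
    elim: k => [|k IH]; first by rewrite expr0 mul1r; apply: v_op_sub.
    by rewrite exprS -mulrA; apply: Hx.
  move=> /(_ d Hd); rewrite (_ : d * i * x ^+ k = x ^+ k * i * d) //; ring.
apply/w_integral_closureP => M tM; rewrite EF //.
have [d1 d2] := dF M tM.
have AV : A `<=` F1 M `&` F2 M.
  by rewrite -EF // => y Ay; apply: sub_integral; [apply: (localize_full tM).1|
    apply: t_max_sub_localize].
have c0 : d * i != 0 by rewrite mulf_neq0.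
by split; [apply: dvr_almost_integral d1 c0 _|apply: dvr_almost_integral d2 c0 _]
  => k; have [] := AV _ (Axk k).
Qed.

Lemma integral_localize M x : t_max A M -> integral_elt (localize A A M) x ->
  exists t, [/\ A t, ~ M t & integral_elt A (t * x)].
Proof.
move=> tM Hx; have [r [t [Dr Dt E]]] := local_quadratic (localize_stable tM) Hx.
have [|u [Au nu Hu]] := @localize_clear M [:: r; t] tM.
  by move=> y; rewrite !inE => /orP[] /eqP->.
have Ar : A (u * r) by apply: Hu; rewrite inE eqxx.
have At : A (u * t) by apply: Hu; rewrite !inE eqxx orbT.
exists u; split=> //; exists [:: 1; u * x]; split.
  by exists 1; rewrite ?oner_neq0 // inE eqxx.
move=> y; rewrite !inE => /orP[] /eqP->; apply/span2P.
  by exists 0, 1; rewrite mulr1 mul0r mul1r add0r; split=> //; apply: rng0.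
exists (u * (u * r)), (u * t); split=> //; first exact: rngM.
rewrite (_ : u * x * (u * x) = u ^+ 2 * x ^+ 2); last by ring.
by rewrite E; ring.
Qed.

Section EveryIdealBelowTMax.
(* As all maximal ideals are t-ideals, w is the identity on ideals. *)
Hypothesis coverA : forall N, proper_ideal A N -> exists2 M, t_max A M & N `<=` M.

Local Notation B := (integral_elt A).
Let sB : subring B := integral_subring sA.
Let rB : rng B. Proof. by case: sB. Qed.
Let AB : A `<=` B := sub_integral sA.

Lemma cover_mem (L : set K) : submodule A L -> L `<=` A ->
  (forall M, t_max A M -> exists2 s, L s & ~ M s) -> L 1.
Proof.
move=> mL LA H; apply: contrapT => n1; have [L0 LD LZ] := mL.
have [|M tM LM] := @coverA L; last by have [s /LM] := H M tM.
split=> //; last first.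
by split=> //; [move=> x y; apply: submodB mL|move=> x y /LA Ax; apply: LZ].
Qed.

Lemma w_integral_closure_cover : w_integral_closure A = B.
Proof.
apply/seteqP; split=> x; last first.
  move=> Hx; apply/w_integral_closureP => M tM.
  by apply: integral_eltS Hx; apply: t_max_sub_localize.
move=> /w_integral_closureP H.
pose L := [set t | A t /\ B (t * x)].
suff [_] : L 1 by rewrite mul1r.
apply: cover_mem => [|? []//|M tM].
  split; first by split; rewrite ?mul0r; apply: rng0.
    by move=> t u [? ?] [? ?]; split; rewrite ?mulrDl; apply: rngD.
  move=> a t Aa [? ?]; split; rewrite -?mulrA; apply: rngM => //.
  exact: AB.
by have [t [At nt Bt]] := integral_localize tM (H M tM); exists t.
Qed.

Lemma krull_dim_one : krull_dim A 1.
Proof.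
split.
  have [M tM] := ex_t_max; exists (fun=> M); split=> // i _.
  exact: t_max_nonzero_prime.
move=> [|[|m]] // [P [HP incP]]; exfalso.
have [pP0 nz0] := nonzero_primeP (HP 0%N isT).
have [pP1 nz1] := nonzero_primeP (HP 1%N isT).
have [M tM PM] := coverA pP1.1.
have [P01 nP] := incP 0%N isT.
have E := t_max_height_one tM pP0 nz0 (subset_trans P01 PM).
by apply: nP; rewrite E.
Qed.

Lemma integral_relation_at M x : t_max A M -> B x -> exists u r t,
  [/\ ~ M u, A u, A r & A t] /\ u * x ^+ 2 = r + t * x.
Proof.
move=> tM Bx; have Hx : integral_elt (localize A A M) x.
  by apply: integral_eltS Bx; apply: t_max_sub_localize.
have [r [t [Dr Dt E]]] := local_quadratic (localize_stable tM) Hx.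
have [|u [Au nu Hu]] := @localize_clear M [:: r; t] tM.
  by move=> y; rewrite !inE => /orP[] /eqP->.
exists u, (u * r), (u * t); split; last by rewrite E; ring.
by split=> //; apply: Hu; rewrite !inE eqxx ?orbT.
Qed.

(** The trace of P on A is nonzero: from u a^2 = r + t a with a in P, either r is a nonzero element
    of it, or r = 0 and u a = t is one. Height one then makes it t-maximal. *)
Lemma contract_prime P : prime_ideal B P -> (exists2 x, P x & x != 0) ->
  t_max A (P `&` A).
Proof.
move=> [pP prP] [a Pa a0]; have rP := pideal_rng pP.
have pQ : prime_ideal A (P `&` A).
  split; last first.
    move=> x y Ax Ay [Pxy _].
    by have [Px|Py] := prP _ _ (AB Ax) (AB Ay) Pxy; [left|right].
  split.
  - by move=> x [].
  - split; first by split; apply: rng0.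
      by move=> x y [? ?] [? ?]; split; apply: rngB.
    by move=> x y [? ?] [? ?]; split; apply: rngM.
  - by move=> x y Ax [Py Ay]; split; [apply: (pidealM pP); rewrite //; apply: AB|apply: rngM].
  - by move=> [/(pideal1 pP)].
have [M tM QM] := coverA pQ.1.
rewrite (t_max_height_one tM pQ) //.
have Ba := pideal_sub pP Pa.
have [u [r [t [[nu Au Ar At] E]]]] := integral_relation_at tM Ba.
have [r0|r0] := eqVneq r 0.
  have Eua : u * a = t.
    by apply: (mulIf a0); rewrite -mulrA -expr2 E r0 add0r.
  exists (u * a); last by rewrite mulf_neq0 // (prime_neq0 (t_max_prime tM) nu).
  by split; [apply: (pidealM pP) => //; apply: AB|rewrite Eua].
exists r => //; split=> //.
have -> : r = (u * a - t) * a by rewrite mulrBl -mulrA -expr2 E addrK.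
by apply: (pidealM pP) => //; apply: rngB => //; [apply: rngM => //|]; apply: AB.
Qed.

(** At each M the union U of the chain has a common generator h in the two DVRs; h is in some [I n],
    and from there on the chain is constant at M. Only the finitely many M where x0 in [I 0] is not
    a unit matter, since [I 0] already contains U at the others. *)
Lemma integral_noetherian : noetherian B.
Proof.
move=> I dI incI; have incI' n m : (n <= m)%N -> I n `<=` I m.
  elim: m => [|m IH]; first by rewrite leqn0 => /eqP->.
  rewrite leq_eqVlt => /orP[/eqP->//|/IH H].
  exact: subset_trans H (incI m).
have mI n : submodule B (I n) by have [[]] := dI n.
have IB n : I n `<=` B by have [] := dI n.
have [x0 Ix0 x00] : exists2 x, I 0%N x & x != 0 by have [[]] := dI 0%N.
pose U := \bigcup_n I n.
have local_stat M : t_max A M -> exists n, forall z, U z ->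
    exists2 s, A s & ~ M s /\ I n (s * z).
  move=> tM; have [V1 [P1 [V2 [P2 [[[l1 _] d1] [[l2 _] d2] E _ _]]]]] :=
    local_two_dvr (localize_stable tM).
  have UE z : U z -> V1 z /\ V2 z.
    move=> [n _ /IB Bz]; suff : integral_elt (localize A A M) z by rewrite E.
    by apply: integral_eltS Bz; apply: t_max_sub_localize.
  have nzU : exists2 x, U x & x != 0 by exists x0 => //; exists 0%N.
  have gen V : dvr V -> (forall z, U z -> V z) -> exists f, generates V f U.
    move=> dV UV; apply: dvr_generates => //; exists 1; rewrite ?oner_neq0 //.
    by move=> z /UV; rewrite mul1r.
  have [f Hf] := gen V1 d1 (fun z Uz => (UE z Uz).1).
  have [g Hg] := gen V2 d2 (fun z Uz => (UE z Uz).2).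
  have UD x y : U x -> U y -> U (x + y).
    move=> [n _ Ix] [m _ Iy]; exists (maxn n m) => //.
    have [_ ID _] := mI (maxn n m).
    by apply: ID; [apply: (incI' n)|apply: (incI' m)]; rewrite // ?leq_maxl ?leq_maxr.
  have [h [h0 [n _ Ih] H1] [_ _ H2]] := common_generator l1 l2 UD Hf Hg.
  exists n => z Uz.
  have : integral_elt (localize A A M) (z / h).
    by rewrite E; split; [apply: H1|apply: H2].
  move=> /(integral_localize tM)[t [At nt Bt]]; exists t => //; split=> //.
  rewrite -(divfK h0 z) mulrA; have [_ _] := mI n; exact.
have [l Hl] : exists l : seq (set K), [set M | t_max A M /\
    ~ (localize A A M x0 /\ localize A A M x0^-1)] = [set` l].
  exact/finite_seqP/t_max_unit_finite.
have [N HN] : exists N, forall M, M \in l -> t_max A M -> forall z, U z ->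
    exists2 s, A s & ~ M s /\ I N (s * z).
  elim: l {Hl} => [|M l [N HN]]; first by exists 0%N.
  have [tM|ntM] := pselect (t_max A M); last first.
    by exists N => M'; rewrite inE => /orP[/eqP->//|]; apply: HN.
  have [n Hn] := local_stat M tM; exists (maxn n N) => M'.
  rewrite inE => /orP[/eqP-> _ z /Hn[s As [ns Is]]|/HN H tM' z /(H tM')[s As [ns Is]]].
    by exists s => //; split=> //; apply: incI' Is; apply: leq_maxl.
  by exists s => //; split=> //; apply: incI' Is; apply: leq_maxr.
suff UN : U `<=` I N.
  exists N => n leN; apply/seteqP; split; last exact: incI'.
  by move=> z Iz; apply: UN; exists n.
move=> z Uz; have [I0 ID IZ] := mI N.
suff [_] : [set s | A s /\ I N (s * z)] 1 by rewrite mul1r.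
apply: cover_mem => [|? []//|M tM].
  split; first by split; rewrite ?mul0r //; apply: rng0.
    by move=> s t [? ?] [? ?]; split; rewrite ?mulrDl; [apply: rngD|apply: ID].
  by move=> a s Aa [? ?]; split; rewrite -?mulrA; [apply: rngM|apply: IZ => //; apply: AB].
have [Ml|nMl] := pselect (M \in l).
  by have [s As [ns Is]] := HN M Ml tM z Uz; exists s.
have : localize A A M x0^-1.
  apply: contrapT => n; apply: nMl.
  suff : [set` l] M by [].
  by rewrite -Hl; split=> // -[].
move=> /(t_max_localizeP _ tM (submod_self sA))[t [At nt Atx]]; exists t => //.
split=> //; apply: (incI' 0%N) => //.
have [n _ /IB Bz] := Uz.
rewrite (_ : t * z = t / x0 * z * x0); last by field.
have [_ _ IZ0] := mI 0%N; apply: IZ0 => //; apply: rngM => //; exact: AB.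
Qed.

Lemma integral_integrally_closed : integral_closure B = B.
Proof.
apply/seteqP; split; last exact: sub_integral_closure.
move=> x /(monic_integral_elt sB) Hx.
rewrite -w_integral_closure_cover; apply/w_integral_closureP => M tM.
have [V1 [P1 [V2 [P2 [[v1 _] [v2 _] E _ _]]]]] :=
  local_two_dvr (localize_stable tM).
have BV : B `<=` V1 `&` V2.
  by rewrite -E; apply: integral_eltS; apply: t_max_sub_localize.
rewrite E; split; [apply: (valuation_integrally_closed v1)|
  apply: (valuation_integrally_closed v2)]; apply: integral_eltS Hx.
  by move=> y /BV[].
by move=> y /BV[].
Qed.

(** The center in B of a DVR above A gives a nonzero prime. For incomparability, let primes P0
    inside P1 have the same trace on A, and let u x^2 = r + t x with x in P1 and u outside P0. Then
    r is in P0; if x is not, u x - t is in P0, so t is in the trace and u x is in P0, a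
    contradiction. *)
Lemma integral_krull_dim_one : krull_dim B 1.
Proof.
split.
  have [M tM] := ex_t_max.
  have [V1 [P1 [V2 [P2 [[v1 _] _ E over _]]]]] :=
    local_two_dvr (localize_stable tM).
  have [[[rV V11] pP u] _] := v1; have rP := pideal_rng pP.
  have BV : B `<=` V1.
    move=> x Bx; have : integral_elt (localize A A M) x.
      by apply: integral_eltS Bx; apply: t_max_sub_localize.
    by rewrite E => -[].
  exists (fun=> P1 `&` B); split=> // i _; split.
  - apply: integral_idealP => //; last first.
    + have [m Mm m0] := nonzero_t_max tM; exists m => //; split.
        by have [] := over m (t_max_sub_localize tM Mm).
      by apply/AB/(pideal_sub (t_max_proper tM)).
    split; first by split; apply: rng0.
      by move=> x y [? ?] [? ?]; split; apply: rngD.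
    by move=> x y Bx [? ?]; split; [apply: (pidealM pP) => //; apply: BV|apply: rngM].
  - move=> E1; apply: (pideal1 pP); have : B 1 by case: sB.
    by rewrite -E1 => -[].
  - move=> x y Bx By [Pxy _]; apply: contrapT => /not_orP[nx ny].
    have nPx : ~ P1 x by move=> Px; apply: nx.
    have nPy : ~ P1 y by move=> Py; apply: ny.
    have Vx := u _ (BV _ Bx) nPx; have Vy := u _ (BV _ By) nPy.
    apply: (pideal1 pP).
    have x0 := local_neq0 v1.1 nPx; have y0 := local_neq0 v1.1 nPy.
    have -> : 1 = y^-1 * x^-1 * (x * y) by field; rewrite x0 y0.
    by apply: (pidealM pP) => //; apply: rngM.
move=> [|[|m]] // [P [HP incP]]; exfalso.
have npr Q : nonzero_prime B Q -> prime_ideal B Q /\ exists2 x, Q x & x != 0.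
  move=> [[[mQ nz _] QB] nQ pr]; split=> //; split=> //.
  have [Q0 QD QZ] := mQ; split=> //.
  - by split=> // x y; [apply: (submodB sB mQ)|move=> /QB Bx; apply: QZ].
  - move=> Q1; apply: nQ; apply/seteqP; split=> // x Bx.
    by rewrite -[x]mulr1; apply: QZ.
have [pP0 nz0] := npr _ (HP 0%N isT); have [pP1 nz1] := npr _ (HP 1%N isT).
have [P01 nP] := incP 0%N isT; apply: nP => x P1x; apply: contrapT => nx.
have t0 := contract_prime pP0 nz0; have t1 := contract_prime pP1 nz1.
have E : P 1%N `&` A = P 0%N `&` A.
  by apply/esym/t_max_eq => // y [Py Ay]; split=> //; apply: P01.
have Bx := pideal_sub pP1.1 P1x.
have [u [r [t [[nu Au Ar At] Eux]]]] := integral_relation_at t0 Bx.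
have Pr : P 0%N r.
  have : (P 1%N `&` A) r.
    split=> //; have -> : r = (u * x - t) * x by rewrite mulrBl -mulrA -expr2 Eux addrK.
    apply: (pidealM pP1.1) => //; apply: rngB; rewrite //; last exact: AB.
    by apply: rngM => //; apply: AB.
  by rewrite E => -[].
have Bux : B (u * x) by apply: rngM => //; apply: AB.
have But : B (u * x - t) by apply: rngB => //; apply: AB.
have : P 0%N ((u * x - t) * x).
  by rewrite mulrBl -mulrA -expr2 Eux addrK.
move=> /(pP0.2 _ _ But Bx)[Put|//].
have Pt : P 0%N t.
  have : (P 1%N `&` A) t.
    split=> //; rewrite -(subKr (u * x) t).
    apply: (rngB (pideal_rng pP1.1)); last exact: P01.
    by apply: (pidealM pP1.1) => //; apply: AB.
  by rewrite E => -[].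
have : P 0%N (u * x) by rewrite -(subrK t (u * x)); apply: (rngD (pideal_rng pP0.1)).
by move=> /(pP0.2 _ _ (AB Au) Bx)[Pu|//]; apply: nu.
Qed.

Lemma integral_dedekind : dedekind B.
Proof.
split; [exact: integral_noetherian|exact: integral_integrally_closed|
  exact: integral_krull_dim_one].
Qed.

End EveryIdealBelowTMax.
End LocallyStable.
End Global.

(** * The domain R inside its field of fractions *)

Section Base.
Variable R : idomainType.
Local Notation tofrac := (@FracField.tofrac R).

Lemma base_subring : subring (base R).
Proof.
split; last by exists 1; rewrite ?tofrac1.
split; first by exists 0; rewrite ?tofrac0.
  by move=> _ _ [x _ <-] [y _ <-]; exists (x - y); rewrite ?tofracB.
by move=> _ _ [x _ <-] [y _ <-]; exists (x * y); rewrite ?tofracM.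
Qed.

Lemma fractionP (z : {fraction R}) : exists x y : R,
  y != 0 /\ z = tofrac x / tofrac y.
Proof.
elim/quotW: z => x; exists \n_x, \d_x; split; first exact: denom_ratioP.
apply: (canRL (mulfK _)); first by rewrite tofrac_eq0 denom_ratioP.
unlock FracField.tofrac; rewrite -[LHS]FracField.pi_mul.
apply/eqmodP; rewrite /= FracField.equivfE /FracField.mulf.
by rewrite !numden_Ratio ?mulr1 ?oner_neq0 ?mulf_neq0 ?denom_ratioP // mulrC.
Qed.

Lemma base_full : full_ring (base R).
Proof.
split; first exact: base_subring.
move=> z; have [x [y [y0 ->]]] := fractionP z.
exists (tofrac x), (tofrac y); split; [by exists x|by exists y| |by []].
by rewrite tofrac_eq0.
Qed.

Lemma base_nonfield : (exists2 x : R, x != 0 & x \isn't a GRing.unit) ->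
  exists x, [/\ base R x, x != 0 & ~ base R x^-1].
Proof.
move=> [x x0 nu]; exists (tofrac x); split; first by exists x.
  by rewrite tofrac_eq0.
move=> [y _ E]; move/negP: nu; apply; apply/unitrP; exists y.
suff H : x * y = 1 by rewrite mulrC H.
apply/eqP; rewrite -tofrac_eq tofracM E tofrac1 mulfV //.
by rewrite tofrac_eq0.
Qed.

(** Multiplication by x on the generators has a matrix over R, whose characteristic polynomial is
    monic with root x. The matrix is transposed because [eigenvalueP] uses row vectors. *)
Lemma integral_elt_base : integral_elt (base R) = integral_closure (base R).
Proof.
apply/seteqP; split; last exact/monic_integral_elt/base_subring.
move=> x [s [[y ys y0] Hs]]; pose n := size s.
have /choice[c Hc] (i : 'I_n) : exists c : 'I_n -> R,
    x * s`_i = \sum_(j < n) tofrac (c j) * s`_j.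
  have [d [Dd ->]] := Hs _ (mem_nth 0 (ltn_ord i)).
  have /choice[c Ec] (j : 'I_n) : exists a : R, tofrac a = d j.
    by have [a _ <-] := Dd j; exists a.
  by exists c; apply: eq_bigr => j _; rewrite Ec.
pose C : 'M[R]_n := \matrix_(j, i) c i j.
exists (map_poly tofrac (char_poly C)); split.
- exact/monic_map/char_poly_monic.
- by move=> i; rewrite coef_map; exists (char_poly C)`_i.
rewrite map_char_poly -eigenvalue_root_char; apply/eigenvalueP.
exists (\row_j s`_j).
  apply/rowP => i; rewrite !mxE Hc; apply: eq_bigr => j _.
  by rewrite !mxE mulrC.
apply: contraNneq y0 => E; rewrite -(nth_index 0 ys).
have lt : (index y s < n)%N by rewrite index_mem.
by move/rowP: E => /(_ (Ordinal lt)); rewrite !mxE /= => ->.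
Qed.

End Base.

(** * The identity operation *)

Section Cover.
Variables (K : fieldType) (A : set K).
Hypothesis fullA : full_ring A.
Hypothesis moriA : mori A.
Hypothesis nonfieldA : exists x, [/\ A x, x != 0 & ~ A x^-1].

Let sA : subring A. Proof. by case: fullA. Qed.
Let rA : rng A. Proof. by case: sA. Qed.
Let A1 : A 1. Proof. by case: sA. Qed.

Lemma maximal_nonzero N : maximal_ideal A N -> exists2 x, N x & x != 0.
Proof.
move=> [pN mN]; apply: contrapT => H; have [x [Ax x0 nx]] := nonfieldA.
have [y Ay Ny] : exists2 y, A y & N (1 - x * y).
  by apply: mN => // Nx; apply: H; exists x.
apply: nx; suff -> : x^-1 = y by [].
have [/eqP|n0] := eqVneq (1 - x * y) 0; last by case: H; exists (1 - x * y).
by rewrite subr_eq0 => /eqP E; rewrite -[x^-1]mulr1 E mulKf.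
Qed.

Lemma maximal_integral_ideal N : maximal_ideal A N -> integral_ideal A N.
Proof.
move=> mN; have [pN _] := mN; apply: integral_idealP => //.
- exact: pideal_submod.
- exact: pideal_sub pN.
- exact: maximal_nonzero.
Qed.

Lemma cover_of_maximal :
    (forall N, maximal_ideal A N -> ~ v_op A N 1) ->
  forall N, proper_ideal A N -> exists2 M, t_max A M & N `<=` M.
Proof.
move=> H N0 pN0; have [N mN N0N] := exists_maximal sA pN0.
have dN : divisorial A (v_op A N).
  apply: divisorial_colon => //.
    by apply: v_op_min; [exact: pideal_sub mN.1|exact: v_op_ring].
  have [x Nx x0] := maximal_nonzero mN; exists x => //.
  exact: v_op_sub.
have [M tM vM] := exists_t_max fullA moriA dN (H N mN).
by exists M => // x /N0N Nx; apply: vM; exact: v_op_sub.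
Qed.

Lemma v_op1_colon N : v_op A N 1 -> colon A N `<=` A.
Proof. by move=> v1 x Hx; have := v1 x Hx; rewrite mul1r. Qed.

(** If N^v = A, then (A : N) = A, so both E = (N : N) and (E : N) lie in A; hence N (E : N) lies in
    N and cannot contain 1. *)
Lemma stable_cover : stable A d_op ->
  forall N, proper_ideal A N -> exists2 M, t_max A M & N `<=` M.
Proof.
move=> st; apply: cover_of_maximal => N mN v1.
have [pN _] := mN; have := st N (maximal_integral_ideal mN).1.
rewrite /d_op /= => E; apply: (pideal1 pN).
have E1 : colon N N 1 by move=> x; rewrite mul1r.
move: E1; rewrite -E; apply: mul_min.
- exact: rng0 (pideal_rng pN).
- by move=> x y; apply: rngD (pideal_rng pN).
move=> x y Nx Jy; apply: (pidealMr pN) => //.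
have sub : colon N N `<=` A.
  by move=> z Hz; apply: (v_op1_colon v1) => w /Hz /(pideal_sub pN).
by apply: (v_op1_colon v1) => w /Jy /sub.
Qed.

(* A maximal divisorial ideal among the (x A : y) inside a prime is prime. *)
Lemma prime_contains_divisorial N : nonzero_prime A N -> exists Q,
  [/\ nonzero_prime A Q, v_op A Q = Q & Q `<=` N].
Proof.
move=> prN; have [[[mN [x Nx x0] _] NA] nN pr] := prN.
pose q y := colon A [set z | z = 1 \/ z = y / x].
have qP y z : q y z <-> A z /\ A (z * (y / x)) by exact: colon1P.
have qx y : A y -> q y x.
  by move=> Ay; apply/qP; split; [exact: NA|rewrite mulrC divfK].
pose G Y := exists y, [/\ A y, Y = q y & q y `<=` N].
have dG Y : G Y -> divisorial A Y.
  move=> [y [Ay -> _]]; apply: divisorial_colon1 => //; exists x; first exact: NA.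
  by split=> //; rewrite mulrC divfK.
have [|_ [[y [Ay -> qN]] max]] := @acc_max K _ G moriA dG.
  exists (q 1), 1; split=> // z /qP[Az]; rewrite mul1r => Azx.
  by rewrite -(divfK x0 z); have [_ _] := mN; apply.
exists (q y); have [iq vq] : divisorial A (q y) by apply: dG; exists y.
split=> //; split=> //.
  by move=> E; apply: nN; apply/seteqP; split=> //; rewrite -E.
move=> a b Aa Ab /qP[_ Habx]; have [qb|nqb] := pselect (q y b); [by right|left].
have E (c : K) : A c -> q (y * c) `<=` N -> q (y * c) = q y.
  move=> Ac sub; apply: max; first by exists (y * c); split=> //; apply: rngM.
  move=> z /qP[Az Hz]; apply/qP; split=> //.
  by rewrite (_ : _ * _ = z * (y / x) * c); [apply: rngM|ring].
(* If s in [q (y * b)] were outside N, then [q (y * s)] would lie in N, since s times it lies in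
   [q y]. By maximality it would equal [q y], yet it contains b. *)
have <- : q (y * b) = q y.
  apply: (E) => // s /qP[As Hs]; apply: contrapT => nNs; apply: nqb.
  rewrite -(E s) //.
    by apply/qP; split=> //; rewrite (_ : _ * _ = s * (y * b / x)) //; ring.
  move=> z /qP[Az Hz]; have : N (z * s).
    by apply: qN; apply/qP; split; [apply: rngM|rewrite (_ : _ * _ = z * (y * s / x)) //; ring].
  by move=> /(pr _ _ Az As)[].
apply/qP; split=> //; rewrite (_ : _ * _ = a * b * (y / x)) //; ring.
Qed.

(** In dimension one the divisorial prime found inside N must be N itself. *)
Lemma krull_dim_cover : krull_dim A 1 ->
  forall N, proper_ideal A N -> exists2 M, t_max A M & N `<=` M.
Proof.
move=> [_ dim]; apply: cover_of_maximal => N mN v1.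
have [pN prN] := maximal_prime mN; have iN := maximal_integral_ideal mN.
have nN : nonzero_prime A N.
  by split=> // E; apply: (pideal1 pN); rewrite E.
have [Q [nQ vQ QN]] := prime_contains_divisorial nN.
suff E : Q = N by apply: (pideal1 pN); rewrite -E -vQ E.
apply/seteqP; split=> //; apply: contrapT => NQ.
suff /dim : has_chain (nonzero_prime A) 2 by [].
by exists (fun i => if i == 0%N then Q else N); split=> [[|i]|[|i]] //= _.
Qed.

(* If N were maximal and not divisorial, N = N^2 J and J <= R would make N
   idempotent, hence so would N R', which is finitely generated. *)
Lemma clifford_noetherian_cover : clifford_regular A d_op ->
    noetherian (integral_elt A) ->
  forall N, proper_ideal A N -> exists2 M, t_max A M & N `<=` M.
Proof.
move=> cl noeth; apply: cover_of_maximal => N mN v1.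
have [pN _] := mN; have iN := maximal_integral_ideal mN.
have [J _] := cl N iN.1; rewrite /d_op => EN.
have NA := pideal_sub pN; have mNm := pideal_submod pN.
have subA := v_op1_colon v1; have rN := pideal_rng pN.
have JA : J `<=` A.
  move=> j Jj; apply: (subA) => n Nn; apply: (subA) => n' Nn'; apply: NA.
  rewrite EN (_ : j * n * n' = n * n' * j); last by ring.
  by apply: mem_mul => //; apply: mem_mul.
have NN : N `<=` mul N N.
  rewrite {1}EN; have [M0 MD MZ] := mul_submod N mNm; apply: mul_min => // x j Hx Jj.
  by rewrite mulrC; apply: MZ => //; apply: JA.
set B := integral_elt A in noeth; have sB : subring B := integral_subring sA.
have [rB B1] := sB; have AB : A `<=` B := sub_integral sA.
pose G Y := exists s, [/\ exists2 x, x \in s & x != 0,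
  forall x, x \in s -> N x & Y = span B s].
have [||_ [[s [nz sN ->]] max]] := @acc_max K (integral_ideal B) G noeth.
- move=> _ [s [[x xs x0] sN ->]]; apply: integral_idealP => //.
  + exact: span_submod.
  + by apply: span_min => [|x' x's]; [apply: submod_self|apply/AB/NA/sN].
  + by exists x => //; apply: mem_span.
- have [x Nx x0] := maximal_nonzero mN.
  exists (span B [:: x]), [:: x]; split=> //; first by exists x; rewrite // inE.
  by move=> y; rewrite inE => /eqP->.
have Ns n : N n -> span B s n.
  move=> Nn; rewrite -(max (span B (n :: s))).
  - by apply: mem_span; rewrite // inE eqxx.
  - exists (n :: s); split=> //.
      by case: nz => y ys y0; exists y; rewrite // inE ys orbT.
    by move=> y; rewrite inE => /orP[/eqP->|/sN].
  apply: span_min => [|y ys]; first exact: span_submod.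
  by apply: mem_span; rewrite // inE ys orbT.
have [L0 LD LZ] := mul_submod B mNm.
have rL : rng (mul N B).
  split=> //.
    by move=> x y Lx Ly; apply: (submodB sA (mul_submod B mNm)).
  move=> x y Hx Hy.
  apply: (mul_min (Q := [set x | mul N B (x * y)])) Hx => /=.
  - by rewrite mul0r.
  - by move=> *; rewrite mulrDl; apply: LD.
  move=> n b Nn Bb.
  apply: (mul_min (Q := [set y | mul N B (n * b * y)])) Hy => /=.
  - by rewrite mulr0.
  - by move=> *; rewrite mulrDr; apply: LD.
  move=> n' b' Nn' Bb'; rewrite -mulrA; apply: mem_mul => //.
  by apply: rngM => //; apply: rngM => //; apply/AB/NA.
(* Each generator in s lies in N N, and N lies in B s, so the generators lie in (N B) s and the
   determinant trick gives 1 in N B. Lying over then brings 1 into N. *)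
have [t [Ht E1]] : mul N B 1.
  apply: (nakayama rL nz) => f /sN /NN.
  apply: mul_min.
  - by exists (fun=> 0); split=> //; rewrite big1 // => i _; rewrite mul0r.
  - move=> _ _ [c [Hc ->]] [d [Hd ->]]; exists (fun i => c i + d i).
    split=> [i|]; first exact: LD.
    by rewrite -big_split; apply: eq_bigr => i _; rewrite mulrDl.
  move=> n n' Nn /Ns[c [Bc ->]]; exists (fun i => n * c i); split=> [i|].
    exact: mem_mul.
  by rewrite mulr_sumr; apply: eq_bigr => i _; rewrite mulrA.
apply: (pideal1 pN).
apply: (@integral_nakayama K A N [seq p.2 | p <- t]) => //.
- by move=> d l Ad Nl; apply: (pidealM pN).
- by move=> _ /mapP[p /Ht[_ Bp] ->].
exists (fun i => if (i < size t)%N then (nth (0, 0) t i).1 else 0); split.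
  by move=> i; case: ifP => [lt|_]; [have [] := Ht _ (mem_nth (0, 0) lt)|apply: rng0].
rewrite E1 (big_nth (0, 0)) big_mkord size_map; apply: eq_bigr => i _.
by rewrite ltn_ord (nth_map (0, 0)).
Qed.

Section CoverOps.
Hypothesis coverA : forall N, proper_ideal A N -> exists2 M, t_max A M & N `<=` M.

Lemma w_op_cover I : submodule A I -> w_op A I = I.
Proof.
move=> mI; have [I0 ID IZ] := mI.
apply/seteqP; split; last exact: (w_op_sub fullA moriA).
move=> z Hz; suff [_] : [set t | A t /\ I (t * z)] 1 by rewrite mul1r.
apply: (cover_mem fullA coverA) => [|? []//|M tM].
  split; first by split; rewrite ?mul0r //; apply: rng0.
    by move=> t u [? ?] [? ?]; split; rewrite ?mulrDl; [apply: rngD|apply: ID].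
  by move=> a t Aa [? ?]; split; rewrite -?mulrA; [apply: rngM|apply: IZ].
have [t [At nt It]] := (t_max_localizeP fullA moriA z tM mI).1 (Hz M tM).
by exists t.
Qed.

Lemma clifford_cover : clifford_regular A (w_op A) <-> clifford_regular A d_op.
Proof.
split=> cl I iI; have [J iJ E] := cl I iI; exists J => //; move: E;
  have [mI _ _] := iI; have mM := mul_submod J (mul_submod I mI);
  by rewrite (w_op_cover mI) (w_op_cover mM).
Qed.

Lemma stable_cover_w : stable A (w_op A) -> stable A d_op.
Proof.
move=> st I iI; have := st I iI; have [mI _ _] := iI.
by rewrite /d_op /= (w_op_cover mI) w_op_cover //; apply: mul_submod.
Qed.

End CoverOps.
End Cover.

(** * Consequences of Clifford regularity and the equivalences *)

Section Main.
Variables (K : fieldType) (A : set K).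
Hypothesis fullA : full_ring A.
Hypothesis moriA : mori A.
Hypothesis nonfieldA : exists x, [/\ A x, x != 0 & ~ A x^-1].

Lemma clifford_w_regular_consequences : clifford_regular A (w_op A) ->
  [/\ t_dim A 1, stable A (w_op A), krull (w_integral_closure A) &
    w_integral_closure A = complete_integral_closure A].
Proof.
move=> cl; have fs M := @clifford_w_finitely_stable K A fullA moriA M cl.
split; [exact: t_dim_one|exact: w_stable|exact: krull_w_integral_closure|
  exact: w_integral_closure_complete].
Qed.

Lemma clifford_regular_consequences : clifford_regular A d_op ->
    (forall N, proper_ideal A N -> exists2 M, t_max A M & N `<=` M) ->
  [/\ krull_dim A 1, stable A d_op, dedekind (integral_elt A) &
    integral_elt A = complete_integral_closure A].
Proof.
move=> /[swap] cov /(clifford_cover fullA moriA cov) cl.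
have fs M := @clifford_w_finitely_stable K A fullA moriA M cl.
have [_ st _ compl] := clifford_w_regular_consequences cl.
split; [exact: krull_dim_one|exact: stable_cover_w|exact: integral_dedekind|].
by rewrite -compl w_integral_closure_cover.
Qed.

Lemma stable_clifford : stable A d_op -> clifford_regular A d_op.
Proof.
move=> st; have cov := stable_cover fullA moriA nonfieldA st.
apply/(clifford_cover fullA moriA cov).
apply: w_stable_clifford => // I iI.
have := st I iI; have [mI _ _] := iI.
by rewrite /d_op /= (w_op_cover fullA moriA cov mI) w_op_cover //; apply: mul_submod.
Qed.

End Main.

Theorem proposition4p3 (R : idomainType)
    (R_not_field : exists2 x : R, x != 0 & x \isn't a GRing.unit)
    (R_mori : mori (base R)) :
  (let A := base R in
   let i := clifford_regular A (w_op A) /\ t_dim A 1 in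
   let ii := clifford_regular A (w_op A) /\ krull (w_integral_closure A) in
   let iii := stable A (w_op A) in
   [/\ i <-> ii, ii <-> iii &
       i \/ ii \/ iii ->
       w_integral_closure A = complete_integral_closure A])
  /\
  (let A := base R in
   let i := clifford_regular A d_op /\ krull_dim A 1 in
   let ii := clifford_regular A d_op /\ dedekind (integral_closure A) in
   let iii := stable A d_op in
   [/\ i <-> ii, ii <-> iii &
       i \/ ii \/ iii ->
       integral_closure A = complete_integral_closure A]).
Proof.
have full := base_full R; have nonfield := base_nonfield R_not_field.
split=> A i ii iii.
  have cons := clifford_w_regular_consequences full R_mori nonfield.
  have st : iii -> clifford_regular A (w_op A) by apply: w_stable_clifford.
  split.
  - by split=> -[cl _]; have [] := cons cl; split.
  - by split=> [[cl _]|/st cl]; have [] := cons cl; rewrite /ii /iii.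
  - by move=> [[cl _]|[[cl _]|/st cl]]; have [] := cons cl.
rewrite /ii -integral_elt_base -/A.
have cons := clifford_regular_consequences full R_mori nonfield.
have st : iii -> clifford_regular A d_op by apply: stable_clifford.
(* Each condition brings its own reason for maximal ideals to be t-ideals: dimension one, the
   integral closure being Noetherian, or stability. *)
have all : i \/ (clifford_regular A d_op /\ dedekind (integral_elt A)) \/ iii ->
    clifford_regular A d_op /\ [/\ krull_dim A 1, stable A d_op,
      dedekind (integral_elt A) & integral_elt A = complete_integral_closure A].
  move=> [[cl dim]|[[cl ded]|H]].
  - by split=> //; apply: cons => //; apply: krull_dim_cover.
  - by split=> //; apply: cons => //; apply: clifford_noetherian_cover; case: ded.
  - by split; [exact: st|apply: cons; [exact: st|exact: stable_cover]].
split.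
- split=> H.
    by have [cl [_ _ ded _]] := all (or_introl H).
  by have [cl [dim _ _ _]] := all (or_intror (or_introl H)).
- split=> H.
    by have [_ []] := all (or_intror (or_introl H)).
  by have [cl [_ _ ded _]] := all (or_intror (or_intror H)).
- by move=> /all[_ []].
Qed.
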